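(* On $H^3$ (upper half space model, coordinates $(x,y,z)$, $z>0$) consider the smooth 1-parameter family of horospherical unit vector fields $$\sigma_t=\cos(tz^2)\,\xi_1+\sin(tz^2)\,\xi_2,\qquad t\in\mathbb R.$$ Then: (a) each $\sigma_t$ is harmonic, with bending $|\nabla\sigma_t|^2=1+4t^2z^4$; (b) for $t\neq0$, $\sigma_t$ is not invariant under any discrete subgroup of isometries of $H^3$ with compact quotient; (c) over any relatively compact domain $U\subset H^3$, the energy $E(\sigma;U)=\tfrac12\int_U|\nabla\sigma|^2\,dV$ of horospherical unit fields $\sigma$ attains its minimum precisely at the invariant horospherical unit fields, and $E(\sigma_t;U)$ converges to this minimum as $t\to0$.
   Context: $H^3=\{(x,y,z):z>0\}$ with metric $ds^2=(dx^2+dy^2+dz^2)/z^2$, Levi-Civita connection $\nabla$ and volume element $dV$. The standard orthonormal frame is $\xi_1=z\,\partial_x$, $\xi_2=z\,\partial_y$, $\xi_3=z\,\partial_z$. A unit vector field is horospherical if it is tangent to a foliation by horospheres, here the standard foliation with leaves $z=\text{const.}$; it can then be written locally as $\sigma=\cos u\,\xi_1+\sin u\,\xi_2$ with $u$ smooth. Such a field is an invariant horospherical unit field (over $U$) if it is a constant-coefficient combination of $\xi_1,\xi_2$ (on $U$), i.e. $u$ is constant. A domain is a connected open set. A smooth unit vector field $\sigma$ is harmonic if $\nabla^*\nabla\sigma=|\nabla\sigma|^2\sigma$, where $\nabla^*\nabla=-\mathrm{Tr}\,\nabla^2$; $|\nabla\sigma|^2$ is called the bending of $\sigma$. *)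

(* Defs.v *)
From HB Require Import structures.
From mathcomp Require Import all_boot all_order all_algebra.
From mathcomp Require Import all_classical all_reals all_analysis.

Set Implicit Arguments.
Unset Strict Implicit.
Unset Printing Implicit Defensive.

Import Order.TTheory GRing.Theory Num.Theory.
Import numFieldNormedType.Exports.

Local Open Scope classical_set_scope.
Local Open Scope ring_scope.

(* C^oo on A (used for A open): every iterated directional derivative of f,
   of any order and in any directions, is differentiable at each point of A. *)
Definition smooth_on (R : realType) (V W : normedModType R) (A : set V)
    (f : V -> W) : Prop :=
  forall (vs : seq V) (p : V), A p ->
    differentiable (foldr (fun v h => 'D_v h) f vs) p.

Definition ix : 'I_3 := @Ordinal 3 0 isT.
Definition iy : 'I_3 := @Ordinal 3 1 isT.
Definition iz : 'I_3 := @Ordinal 3 2 isT.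

Section HyperbolicSpace.
Context {R : realType}.

(* Points and tangent vectors are both given by their (x, y, z) coordinates;
   a vector field X is the function p |-> (components of X p on d_x, d_y, d_z).
   Only its values on the domain under consideration matter. *)
Local Notation E := 'rV[R]_3.

Definition coordx (p : E) : R := p ord0 ix.
Definition coordy (p : E) : R := p ord0 iy.
Definition coordz (p : E) : R := p ord0 iz.

Definition H3 : set E := [set p | 0 < coordz p].

Definition metric (p : E) : 'M[R]_3 := ((coordz p ^+ 2)^-1)%:M.

Definition inner (p v w : E) : R :=
  \sum_i \sum_j metric p i j * v ord0 i * w ord0 j.

Definition partial (i : 'I_3) (f : E -> R) (p : E) : R :=
  'D_(delta_mx ord0 i : E) f p.

(* Gamma^k_ij = 1/2 g^kl (d_i g_jl + d_j g_il - d_l g_ij) *)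
Definition christoffel (k i j : 'I_3) (p : E) : R :=
  2^-1 * \sum_l invmx (metric p) k l *
    (partial i (fun q => metric q j l) p + partial j (fun q => metric q i l) p
     - partial l (fun q => metric q i j) p).

(* Levi-Civita connection:
   (nabla_v Y)^k = v(Y^k) + Gamma^k_ij v^i Y^j at the point p *)
Definition nabla (Y : E -> E) (p v : E) : E :=
  \row_k ('D_v (fun q => Y q ord0 k) p +
          \sum_i \sum_j christoffel k i j p * v ord0 i * Y p ord0 j).

(* The orthonormal frame xi_1 = z d_x, xi_2 = z d_y, xi_3 = z d_z. *)
Definition xi (i : 'I_3) (p : E) : E := coordz p *: delta_mx ord0 i.

Definition bending (s : E -> E) (p : E) : R :=
  \sum_i inner p (nabla s p (xi i p)) (nabla s p (xi i p)).

(* nabla^2_{X,Y} s = nabla_X (nabla_Y s) - nabla_{nabla_X Y} s *)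
Definition nabla2 (s X Y : E -> E) (p : E) : E :=
  nabla (fun q => nabla s q (Y q)) p (X p) - nabla s p (nabla Y p (X p)).

(* nabla^* nabla = - Tr nabla^2 *)
Definition rough_laplacian (s : E -> E) (p : E) : E :=
  - \sum_i nabla2 s (xi i) (xi i) p.

Definition smooth_unit_field (U : set E) (s : E -> E) : Prop :=
  smooth_on U s /\ forall p, U p -> inner p (s p) (s p) = 1.

Definition harmonic_unit_field (U : set E) (s : E -> E) : Prop :=
  smooth_unit_field U s /\
  forall p, U p -> rough_laplacian s p = bending s p *: s p.

(* Smooth unit fields tangent to the foliation by the horospheres z = const;
   the tangent space of a leaf is the kernel of dz. *)
Definition horospherical (U : set E) (s : E -> E) : Prop :=
  smooth_unit_field U s /\ forall p, U p -> coordz (s p) = 0.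

Definition invariant_horospherical (U : set E) (s : E -> E) : Prop :=
  horospherical U s /\
  exists a b : R, forall p, U p -> s p = a *: xi ix p + b *: xi iy p.

Definition sigma (t : R) (p : E) : E :=
  cos (t * coordz p ^+ 2) *: xi ix p + sin (t * coordz p ^+ 2) *: xi iy p.

(* For U included in H3, closure U `&` H3 is the closure of U in H3. *)
Definition relatively_compact (U : set E) : Prop :=
  compact (closure U `&` H3).

Definition domain (U : set E) : Prop := [/\ open U, connected U & U `<=` H3].

Definition pt (q : R * R * R) : E :=
  \row_i (if i == ix then q.1.1 else if i == iy then q.1.2 else q.2).

Definition lebesgue3 :=
  ((@lebesgue_measure R \x @lebesgue_measure R) \x @lebesgue_measure R)%E.

(* dV = sqrt (det g) dx dy dz *)
Definition volume_density (p : E) : R := Num.sqrt (\det (metric p)).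

Definition energy (s : E -> E) (U : set E) : \bar R :=
  ((2^-1)%:E * \int[lebesgue3]_(q in pt @^-1` U)
                 (bending s (pt q) * volume_density (pt q))%:E)%E.

(* H3 as a type, with the subspace topology. *)
Definition hsp : topologicalType := set_type H3.

Definition hval (p : hsp) : E := set_val p.

(* A self-map of H3 as a map between subsets of E; H3 being open, derivatives
   at points of H3 do not depend on the value 0 chosen outside H3. *)
Definition extend (g : hsp -> hsp) : E -> E := 'valL_(0 : E) (hval \o g).

Definition hyp_isometry (g : hsp -> hsp) : Prop :=
  [/\ smooth_on H3 (extend g),
      exists h : hsp -> hsp,
        [/\ cancel g h, cancel h g & smooth_on H3 (extend h)]
    & forall (p : hsp) (v w : E),
        inner (hval (g p)) ('d (extend g) (hval p) v) ('d (extend g) (hval p) w)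
        = inner (hval p) v w].

Record isom_subgroup := IsomSubgroup {
  isoms : set (hsp -> hsp);
  isoms_isometry : forall g, isoms g -> hyp_isometry g;
  isoms1 : isoms id;
  isomsM : forall g h, isoms g -> isoms h -> isoms (g \o h);
  isomsV : forall g h, isoms g -> cancel g h -> cancel h g -> isoms h }.

(* The isometry group carries the compact-open topology. *)
Definition discrete_subgroup (G : isom_subgroup) : Prop :=
  forall g, isoms G g -> isolated (isoms G : set {compact-open, hsp -> hsp}) g.

Definition orbit_rel (G : isom_subgroup) : rel hsp :=
  fun p q => `[< exists2 g, isoms G g & g p = q >].

Lemma orbit_rel_equiv G : equiv_class_of (orbit_rel G).
Proof.
split.
- by move=> p; apply/asboolP; exists id => //; exact: isoms1.
- have sym p q : orbit_rel G p q -> orbit_rel G q p.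
    move=> /asboolP [g Gg gpq]; apply/asboolP.
    have [_ [h [gh hg _]] _] := isoms_isometry Gg.
    by exists h; [exact: (isomsV Gg gh hg) | rewrite -gpq gh].
  by move=> p q; apply/idP/idP; exact: sym.
- move=> q p r /asboolP [g Gg gpq] /asboolP [h Gh hqr]; apply/asboolP.
  by exists (h \o g); [exact: isomsM | rewrite /= gpq].
Qed.

Canonical orbit_equiv (G : isom_subgroup) : equiv_rel hsp :=
  EquivRelPack (orbit_rel_equiv G).

Definition compact_quotient (G : isom_subgroup) : Prop :=
  compact [set: quotient_topology {eq_quot orbit_equiv G}%qT].

(* dg (s p) = s (g p) for every g in G *)
Definition invariant_under (G : isom_subgroup) (s : E -> E) : Prop :=
  forall g, isoms G g -> forall p : hsp,
    'd (extend g) (hval p) (s (hval p)) = s (hval (g p)).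

End HyperbolicSpace.

Arguments H3 R : clear implicits.

(* Main.v *)
Require Import Defs.
From HB Require Import structures.
From mathcomp Require Import all_boot all_order all_algebra.
From mathcomp Require Import all_classical all_reals all_analysis.
From mathcomp Require Import measurable_realfun.
From mathcomp Require Import ring lra.

Import Order.TTheory GRing.Theory Num.Theory.
Import numFieldNormedType.Exports.

Local Open Scope classical_set_scope.
Local Open Scope ring_scope.

Set Implicit Arguments.
Unset Strict Implicit.
Unset Printing Implicit Defensive.

(** The fields [sigma t] only depend on the height [z], and so do the Christoffel
symbols of the metric; part (a) is therefore a computation in one variable, once
the Levi-Civita connection is written out in coordinates ([nablaE],
[nabla_zfield]). Applied twice it gives [rough_laplacian_sigma].

Part (b). An isometry leaving [sigma t] invariant leaves its dual 1-form
  alpha = (cos (t z^2) dx + sin (t z^2) dy) / z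
invariant, hence also the exterior derivative of alpha ([dform_pullback], which
rests on the symmetry of second derivatives, [derive_derive_sym]) and the
pointwise norm of that 2-form. The squared norm is a multiple of 1 + 4 t^2 z^4,
so that for t <> 0 the isometry preserves the height ([coordz_invariant]). If a
group of such isometries had compact quotient, the height would descend to a
continuous function on a compact space and be bounded above, which it is not.
Working with the exterior derivative instead of the bending avoids proving that
the connection is natural under isometries.

Part (c). For a horospherical unit field s on U the components of nabla s split
into those normal to the leaves, contributing exactly 1 to the bending (the
second fundamental form of the horospheres), and those tangent to the leaves.
Hence bending = 1 + [twist] with [twist] >= 0 ([bending_horospherical]), and
the energy is half the volume of U plus half the integral of [twist]
([energy_twist]). The volume is finite because U is relatively compact. Since
[twist] is continuous and nonempty open sets have positive volume, equality
holds if and only if [twist] vanishes on U ([twist_integral_eq0]); this says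
that the coefficients of s on xi_1 and xi_2 have zero derivative, so they are
constant on the connected set U ([twist0_invariant]). For [sigma t] the excess
energy is 2 t^2 times the integral of z in the Euclidean measure
([energy_sigma]), and it tends to 0 with t. *)

(** * Calculus of smooth functions *)

Section SmoothCalculus.
Context {R : realType} {V : normedModType R}.
Implicit Types (A : set V) (n : nat) (p v : V).

Definition iter_derive {W : normedModType R} (vs : seq V) (f : V -> W) : V -> W :=
  foldr (fun v h => 'D_v h) f vs.

(** Smoothness cut off at words of length [n]: the closure properties of smooth
functions are proved by induction on [n], which the unbounded notion does not
allow. *)
Definition Cn_on {W : normedModType R} n A (f : V -> W) : Prop :=
  forall vs, (size vs <= n)%N -> forall p, A p -> differentiable (iter_derive vs f) p.

Lemma smooth_onP {W : normedModType R} A (f : V -> W) :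
  smooth_on A f <-> forall n, Cn_on n A f.
Proof.
split=> [sf n vs _ p Ap|cf vs p Ap]; first exact: sf.
exact: (cf (size vs)).
Qed.

Lemma iter_derive_rcons {W : normedModType R} vs v (f : V -> W) :
  iter_derive (rcons vs v) f = iter_derive vs ('D_v f).
Proof. by rewrite /iter_derive -cats1 foldr_cat. Qed.

Lemma Cn_on0 {W : normedModType R} A (f : V -> W) :
  Cn_on 0 A f <-> forall p, A p -> differentiable f p.
Proof.
split=> [cf p Ap|df vs]; first exact: (cf [::]).
by rewrite leqn0 => /nilP -> p Ap; exact: df.
Qed.

(** The innermost derivative of a word is its last letter, so that a word of
length [n.+1] applied to [f] is a word of length [n] applied to a derivative of
[f]. *)
Lemma Cn_onS {W : normedModType R} n A (f : V -> W) :
  Cn_on n.+1 A f <->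
  (forall p, A p -> differentiable f p) /\ forall v, Cn_on n A ('D_v f).
Proof.
split=> [cf|[df cf]].
  split=> [p Ap|v vs svs p Ap]; first exact: (cf [::]).
  by rewrite -iter_derive_rcons; apply: cf => //; rewrite size_rcons.
move=> vs; case: (lastP vs) => [_ p Ap|{}vs v]; first exact: df.
by rewrite size_rcons iter_derive_rcons => svs p Ap; exact: cf.
Qed.

Lemma Cn_onW {W : normedModType R} n A (f : V -> W) :
  Cn_on n.+1 A f -> Cn_on n A f.
Proof. by move=> cf vs svs; apply: cf; exact: leqW. Qed.

Lemma smooth_on_diff {W : normedModType R} A (f : V -> W) p :
  smooth_on A f -> A p -> differentiable f p.
Proof. by move=> sf; exact: (sf [::]). Qed.

Lemma smooth_on_derive {W : normedModType R} A (f : V -> W) v :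
  smooth_on A f -> smooth_on A ('D_v f).
Proof.
move=> sf vs p Ap.
by have := sf (rcons vs v) p Ap; rewrite -/(iter_derive _ _) iter_derive_rcons.
Qed.

Lemma derive_eq_on {W : normedModType R} A (f g : V -> W) p v :
  open A -> {in A, f =1 g} -> A p -> 'D_v f p = 'D_v g p.
Proof.
move=> oA fg Ap; apply: near_eq_derive.
have : nbhs p A by exact: open_nbhs_nbhs.
by apply: filterS => q Aq; apply: fg; rewrite inE.
Qed.

Lemma near_eq_differentiable {W : normedModType R} (f g : V -> W) p :
  (\near p, f p = g p) -> differentiable f p -> differentiable g p.
Proof.
move=> fg df; have [dfc /eqaddoP dfo] := (diff_locallyP _ _).1 df.
have go : g \o shift p = cst (g p) + 'd f p +o_ 0 id.
  apply/eqaddoP => e e0; rewrite -(nbhs_singleton fg).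
  have fg0 : \forall h \near 0, f (h + p) = g (h + p).
    move: fg; rewrite (near_shift 0 p); apply: filterS => h /=.
    by rewrite subr0.
  apply: filterS2 fg0 (dfo e e0) => h fgh.
  by rewrite /= !fctE /= fgh.
by apply/diff_locallyP; rewrite (diff_unique dfc go).
Qed.

Lemma Cn_on_eq {W : normedModType R} n A (f g : V -> W) :
  open A -> {in A, f =1 g} -> Cn_on n A f -> Cn_on n A g.
Proof.
move=> oA; elim: n => [|n IH] in f g *.
  move=> fg /Cn_on0 df; apply/Cn_on0 => p Ap.
  apply: near_eq_differentiable (df p Ap).
  have : nbhs p A by exact: open_nbhs_nbhs.
  by apply: filterS => q Aq; apply: fg; rewrite inE.
move=> fg /Cn_onS [df cf]; apply/Cn_onS; split=> [p Ap|v].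
  apply: near_eq_differentiable (df p Ap).
  have : nbhs p A by exact: open_nbhs_nbhs.
  by apply: filterS => q Aq; apply: fg; rewrite inE.
apply: IH (cf v) => q; rewrite inE => Aq.
exact: derive_eq_on Aq.
Qed.

Lemma Cn_onD {W : normedModType R} n A (f g : V -> W) : open A ->
  Cn_on n A f -> Cn_on n A g -> Cn_on n A (fun p => f p + g p).
Proof.
move=> oA; elim: n => [|n IH] in f g *.
  move=> /Cn_on0 df /Cn_on0 dg; apply/Cn_on0 => p Ap.
  exact: differentiableD (df p Ap) (dg p Ap).
move=> /Cn_onS [df cf] /Cn_onS [dg cg]; apply/Cn_onS; split=> [p Ap|v].
  exact: differentiableD (df p Ap) (dg p Ap).
apply: Cn_on_eq (IH _ _ (cf v) (cg v)) => // p; rewrite inE => Ap.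
by apply/esym/deriveD; apply: diff_derivable; [exact: df|exact: dg].
Qed.

(** Leibniz' rule needs [f] and [g] themselves at the level [n] of their
derivatives, whence the use of [Cn_onW]. *)
Lemma Cn_onM n A (f g : V -> R) : open A ->
  Cn_on n A f -> Cn_on n A g -> Cn_on n A (fun p => f p * g p).
Proof.
move=> oA; elim: n => [|n IH] in f g *.
  move=> /Cn_on0 df /Cn_on0 dg; apply/Cn_on0 => p Ap.
  exact: differentiableM (df p Ap) (dg p Ap).
move=> cf' cg'; move: (cf') (cg') => /Cn_onS [df cf] /Cn_onS [dg cg].
apply/Cn_onS; split=> [p Ap|v].
  exact: differentiableM (df p Ap) (dg p Ap).
have cv := Cn_onD oA (IH _ _ (Cn_onW cf') (cg v)) (IH _ _ (Cn_onW cg') (cf v)).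
apply: Cn_on_eq cv => // p; rewrite inE => Ap.
by apply/esym/deriveM; apply: diff_derivable; [exact: df|exact: dg].
Qed.

Lemma Cn_onZl {W : normedModType R} n A (f : V -> R) (w : W) : open A ->
  Cn_on n A f -> Cn_on n A (fun p => f p *: w).
Proof.
move=> oA; elim: n => [|n IH] in f *.
  move=> /Cn_on0 df; apply/Cn_on0 => p Ap.
  exact: differentiableZl (df p Ap).
move=> /Cn_onS [df cf]; apply/Cn_onS; split=> [p Ap|v].
  exact: differentiableZl (df p Ap).
apply: Cn_on_eq (IH _ (cf v)) => // p; rewrite inE => Ap.
have dfp := df p Ap.
by rewrite !deriveE ?diffZl //; exact: differentiableZl.
Qed.

Lemma smooth_cst {W : normedModType R} A (w : W) : smooth_on A (cst w : V -> W).
Proof.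
apply/smooth_onP => n; elim: n w => [|n IH] w.
  by apply/Cn_on0 => p _; exact: differentiable_cst.
apply/Cn_onS; split=> [p _|v]; first exact: differentiable_cst.
have -> : 'D_v (cst w : V -> W) = cst 0 by apply/funext => p; exact: derive_cst.
exact: IH.
Qed.

Lemma smooth_linear {W : normedModType R} A (f : {linear V -> W}) :
  continuous f -> smooth_on A f.
Proof.
move=> cf; apply/smooth_onP => -[|n].
  by apply/Cn_on0 => p _; exact: linear_differentiable.
apply/Cn_onS; split=> [p _|v]; first exact: linear_differentiable.
have -> : 'D_v f = cst (f v).
  by apply/funext => p; rewrite deriveE ?diff_lin //; exact: linear_differentiable.
by have /smooth_onP := @smooth_cst W A (f v); exact.
Qed.

Lemma smooth_linear_comp {W W' : normedModType R} A (L : {linear W -> W'}) (f : V -> W) :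
  open A -> continuous L -> smooth_on A f -> smooth_on A (L \o f).
Proof.
move=> oA cL /smooth_onP cf; apply/smooth_onP => n; move: (cf n) => {cf}.
have dL q : differentiable L q by exact: linear_differentiable.
elim: n => [|n IH] in f *.
  by move=> /Cn_on0 df; apply/Cn_on0 => p Ap; exact: differentiable_comp (df p Ap) _.
move=> /Cn_onS [df cf]; apply/Cn_onS; split=> [p Ap|v].
  exact: differentiable_comp (df p Ap) _.
apply: Cn_on_eq (IH _ (cf v)) => // p; rewrite inE => Ap.
have dfp := df p Ap; have dLf := differentiable_comp dfp (dL (f p)).
by rewrite /= !deriveE // (diff_comp dfp (dL (f p))) /= diff_lin.
Qed.

Lemma derive_comp_real (h : R -> R) (f : V -> R) p v dh :
  differentiable f p -> is_derive (f p) 1 h dh ->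
  differentiable (h \o f) p /\ 'D_v (h \o f) p = dh * 'D_v f p.
Proof.
move=> df [dh1 hE].
have dhf : differentiable h (f p) by exact/derivable1_diffP.
have dc : differentiable (h \o f) p by exact: differentiable_comp.
split=> //; rewrite !deriveE // diff_comp //= diff1E //=.
by rewrite derive1E hE mulrC.
Qed.

(** Both functions have to be treated together, since each one occurs in the
derivative of the other. *)
Lemma Cn_on_cos_sin n A (f : V -> R) : open A -> Cn_on n A f ->
  Cn_on n A (fun p => cos (f p)) /\ Cn_on n A (fun p => sin (f p)).
Proof.
move=> oA.
have dcos p : differentiable f p -> differentiable (fun q => cos (f q)) p.
  by move=> df; apply: (derive_comp_real 0 df (is_derive_cos (f p))).1.
have dsin p : differentiable f p -> differentiable (fun q => sin (f q)) p.
  by move=> df; apply: (derive_comp_real 0 df (is_derive_sin (f p))).1.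
elim: n => [|n IH].
  move=> /Cn_on0 df; split; apply/Cn_on0 => p Ap.
    exact/dcos/df.
  exact/dsin/df.
move=> cf'; move: (cf') => /Cn_onS [df cf].
have [cc cs] := IH (Cn_onW cf').
split; apply/Cn_onS; split=> [p Ap|v].
- exact/dcos/df.
- have cm1 : Cn_on n A (cst (-1) : V -> R).
    by have /smooth_onP := @smooth_cst R A (-1); exact.
  have := Cn_onM oA (Cn_onM oA cm1 cs) (cf v).
  apply: Cn_on_eq => // p; rewrite inE => Ap.
  rewrite /cst mulN1r.
  by have [_ ->] := derive_comp_real v (df p Ap) (is_derive_cos (f p)).
- exact/dsin/df.
- have := Cn_onM oA cc (cf v).
  apply: Cn_on_eq => // p; rewrite inE => Ap.
  by have [_ ->] := derive_comp_real v (df p Ap) (is_derive_sin (f p)).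
Qed.

Lemma smoothD {W : normedModType R} A (f g : V -> W) : open A ->
  smooth_on A f -> smooth_on A g -> smooth_on A (fun p => f p + g p).
Proof.
move=> oA /smooth_onP cf /smooth_onP cg; apply/smooth_onP => n.
exact: Cn_onD.
Qed.

Lemma smoothM A (f g : V -> R) : open A ->
  smooth_on A f -> smooth_on A g -> smooth_on A (fun p => f p * g p).
Proof.
move=> oA /smooth_onP cf /smooth_onP cg; apply/smooth_onP => n.
exact: Cn_onM.
Qed.

Lemma smoothZl {W : normedModType R} A (f : V -> R) (w : W) : open A ->
  smooth_on A f -> smooth_on A (fun p => f p *: w).
Proof.
by move=> oA /smooth_onP cf; apply/smooth_onP => n; exact: Cn_onZl.
Qed.

Lemma smooth_cos A (f : V -> R) : open A ->
  smooth_on A f -> smooth_on A (fun p => cos (f p)).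
Proof.
by move=> oA /smooth_onP cf; apply/smooth_onP => n; case: (Cn_on_cos_sin oA (cf n)).
Qed.

Lemma smooth_sin A (f : V -> R) : open A ->
  smooth_on A f -> smooth_on A (fun p => sin (f p)).
Proof.
by move=> oA /smooth_onP cf; apply/smooth_onP => n; case: (Cn_on_cos_sin oA (cf n)).
Qed.

End SmoothCalculus.


(** * The Levi-Civita connection of the upper half space *)

Lemma smooth_linear_fun (R : realType) (V W : normedModType R) (A : set V)
    (f : V -> W) :
  linear f -> continuous f -> smooth_on A f.
Proof.
move=> lf cf.
pose fM := GRing.isLinear.Build _ _ _ _ _ lf.
pose fL : {linear V -> W} := HB.pack f fM.
exact: (@smooth_linear R V W A fL).
Qed.

Section Hyperbolic.
Context {R : realType}.
Local Notation E := 'rV[R]_3.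
Implicit Types (p v w : E) (Y s : E -> E).

Lemma sum3 (V : nmodType) (F : 'I_3 -> V) : \sum_i F i = F ix + F iy + F iz.
Proof.
rewrite !big_ord_recl big_ord0 addr0 addrA.
by congr (F _ + F _ + F _); apply: val_inj.
Qed.

Lemma ord3_ind (P : 'I_3 -> Prop) : P ix -> P iy -> P iz -> forall i, P i.
Proof.
by move=> Px Py Pz [[|[|[|]]]] // h; [move: Px|move: Py|move: Pz];
  congr P; apply: val_inj.
Qed.

Lemma row3P p q : coordx p = coordx q -> coordy p = coordy q ->
  coordz p = coordz q -> p = q.
Proof. by move=> hx hy hz; apply/rowP; apply: ord3_ind. Qed.

Lemma coord_linear (i : 'I_3) : linear (fun p : E => p ord0 i : R).
Proof. by move=> a u v; rewrite !mxE. Qed.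

Lemma coord_smooth (A : set E) (i : 'I_3) : smooth_on A (fun p : E => p ord0 i : R).
Proof. exact: smooth_linear_fun (coord_linear i) (@coord_continuous _ _ _ _ _). Qed.

Lemma derive_coord (i : 'I_3) p v : 'D_v (fun q : E => q ord0 i : R) p = v ord0 i.
Proof.
pose fM := GRing.isLinear.Build _ _ _ _ _ (coord_linear i).
pose fL : {linear E -> R} := HB.pack (fun q : E => q ord0 i : R) fM.
rewrite deriveE; last exact: differentiable_coord.
by rewrite (@diff_lin R E R fL) //; exact: coord_continuous.
Qed.

Lemma coordz_continuous : continuous (@coordz R).
Proof. exact: coord_continuous. Qed.

Lemma open_H3 : open (H3 R).
Proof.
apply: (@open_comp _ _ (@coordz R) [set z | 0 < z]); last exact: open_gt.
by move=> p _; exact: coordz_continuous.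
Qed.

Lemma near_H3 p : H3 R p -> \forall q \near p, 0 < coordz q.
Proof. by move=> pH; have := open_nbhs_nbhs (conj open_H3 pH). Qed.

Lemma derive_zfun (h : R -> R) p v dh : is_derive (coordz p) 1 h dh ->
  'D_v (fun q => h (coordz q)) p = dh * v ord0 iz.
Proof.
move=> hd; have dz : differentiable (@coordz R) p by exact: differentiable_coord.
by have [_ ->] := derive_comp_real v dz hd; rewrite derive_coord.
Qed.

Lemma innerE p v w : inner p v w =
  (coordz p ^+ 2)^-1 * (v ord0 ix * w ord0 ix + v ord0 iy * w ord0 iy
                        + v ord0 iz * w ord0 iz).
Proof. by rewrite /inner !sum3 /metric !mxE /= !mulr1n !mulr0n; ring. Qed.

Lemma partial_metric p (k i j : 'I_3) : H3 R p ->
  partial k (fun q => metric q i j) p =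
  (k == iz)%:R * (i == j)%:R * (- 2 / coordz p ^+ 3).
Proof.
move=> pH; have z0 : coordz p != 0 by rewrite gt_eqF.
pose h : R -> R := ((i == j)%:R : R) \*: (fun z : R => (z ^+ 2)^-1).
have hd : is_derive (coordz p) 1 h ((i == j)%:R * (- 2 / coordz p ^+ 3)).
  have d2 : is_derive (coordz p) 1 (fun z : R => z ^+ 2) (2 * coordz p).
    by apply: is_derive_eq; rewrite /GRing.scale /=; ring.
  have z20 : coordz p ^+ 2 != 0 by rewrite expf_neq0.
  have di := @is_deriveV R (fun z => z ^+ 2) _ _ _ z20 d2.
  apply: (is_derive_eq (is_deriveZ (i == j)%:R di)).
  by rewrite /GRing.scale /=; field.
have -> : (fun q : E => metric q i j) = (fun q => h (coordz q)).
  by apply/funext => q; rewrite /metric mxE /h /= /GRing.scale /= mulr_natl.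
by rewrite /partial (derive_zfun _ hd) mxE eqxx /= [iz == k]eq_sym; ring.
Qed.

(** The metric is z^-2 times the identity, so that only its z-derivative
contributes. *)
Lemma christoffelE p (k i j : 'I_3) : H3 R p ->
  christoffel k i j p = - (coordz p)^-1 *
    ((i == iz)%:R * (j == k)%:R + (j == iz)%:R * (i == k)%:R
     - (k == iz)%:R * (i == j)%:R).
Proof.
move=> pH; have z0 : coordz p != 0 by rewrite gt_eqF.
rewrite /christoffel (bigD1 k) //= big1 ?addr0; last first.
  by move=> l lk; rewrite invmx_scalar mxE eq_sym (negPf lk) mulr0n mul0r.
rewrite invmx_scalar mxE eqxx mulr1n invrK !partial_metric //.
by field.
Qed.

Lemma nablaE Y p v (k : 'I_3) : H3 R p ->
  nabla Y p v ord0 k =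
  'D_v (fun q => Y q ord0 k) p - (coordz p)^-1 *
   (v ord0 iz * Y p ord0 k + v ord0 k * Y p ord0 iz
    - (k == iz)%:R * (v ord0 ix * Y p ord0 ix + v ord0 iy * Y p ord0 iy
                      + v ord0 iz * Y p ord0 iz)).
Proof.
move=> pH; rewrite /nabla mxE; congr (_ + _); rewrite !sum3 !christoffelE //.
by move: k; apply: ord3_ind; rewrite /=; ring.
Qed.

(** Needed because the explicit formulas for [nabla] only hold on [H3], while
[nabla2] differentiates functions defined on the whole coordinate space. *)
Lemma near_eq_nabla Y Y' p v : (\near p, Y p = Y' p) -> nabla Y p v = nabla Y' p v.
Proof.
move=> YY'; rewrite /nabla; apply/rowP => k; rewrite !mxE (nbhs_singleton YY').
congr (_ + _); apply: near_eq_derive.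
by apply: filterS YY' => q ->.
Qed.

End Hyperbolic.

(** * Harmonicity and bending of the family [sigma t] *)

Section Sigma.
Context {R : realType}.
Local Notation E := 'rV[R]_3.
Implicit Types (p v w : E) (Y s : E -> E) (t : R).

Lemma pt_x (a b c : R) : pt (a, b, c) ord0 ix = a.
Proof. by rewrite mxE. Qed.
Lemma pt_y (a b c : R) : pt (a, b, c) ord0 iy = b.
Proof. by rewrite mxE. Qed.
Lemma pt_z (a b c : R) : pt (a, b, c) ord0 iz = c.
Proof. by rewrite mxE. Qed.
Definition ptE := (pt_x, pt_y, pt_z).

Lemma pt_eq p (a b c : R) : p ord0 ix = a -> p ord0 iy = b -> p ord0 iz = c ->
  p = pt (a, b, c).
Proof. by move=> <- <- <-; apply: row3P; rewrite /coordx /coordy /coordz ptE. Qed.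

(** Vector fields whose components only depend on the height. *)
Definition zfield (a b c : R -> R) : E -> E :=
  fun q => pt (a (coordz q), b (coordz q), c (coordz q)).

Lemma nabla_zfield (a b c : R -> R) (da db dc : R) p v : H3 R p ->
  is_derive (coordz p) 1 a da -> is_derive (coordz p) 1 b db ->
  is_derive (coordz p) 1 c dc ->
  nabla (zfield a b c) p v =
  pt (v ord0 iz * (da - a (coordz p) / coordz p) - v ord0 ix * c (coordz p) / coordz p,
      v ord0 iz * (db - b (coordz p) / coordz p) - v ord0 iy * c (coordz p) / coordz p,
      v ord0 iz * (dc - c (coordz p) / coordz p)
      + (v ord0 ix * a (coordz p) + v ord0 iy * b (coordz p)) / coordz p).
Proof.
move=> pH Da Db Dc.
apply: pt_eq; rewrite nablaE // /zfield !ptE /=.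
- rewrite (_ : (fun _ => _) = (fun q => a (coordz q))); last first.
    by apply/funext => q; rewrite ptE.
  by rewrite (derive_zfun _ Da); ring.
- rewrite (_ : (fun _ => _) = (fun q => b (coordz q))); last first.
    by apply/funext => q; rewrite ptE.
  by rewrite (derive_zfun _ Db); ring.
- rewrite (_ : (fun _ => _) = (fun q => c (coordz q))); last first.
    by apply/funext => q; rewrite ptE.
  by rewrite (derive_zfun _ Dc); ring.
Qed.

Lemma xi_x p : xi ix p = pt (coordz p, 0, 0).
Proof. by apply: pt_eq; rewrite /xi !mxE /= ?mulr1 ?mulr0. Qed.
Lemma xi_y p : xi iy p = pt (0, coordz p, 0).
Proof. by apply: pt_eq; rewrite /xi !mxE /= ?mulr1 ?mulr0. Qed.
Lemma xi_z p : xi iz p = pt (0, 0, coordz p).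
Proof. by apply: pt_eq; rewrite /xi !mxE /= ?mulr1 ?mulr0. Qed.

Lemma sigmaE t p :
  sigma t p = pt (coordz p * cos (t * coordz p ^+ 2),
                  coordz p * sin (t * coordz p ^+ 2), 0).
Proof.
rewrite /sigma xi_x xi_y.
by apply: pt_eq; rewrite mxE !(mxE _ _ ord0) /= ?mulr0 ?addr0 ?add0r // mulrC.
Qed.

Lemma is_derive_phase t (z : R) : is_derive z 1 (fun z : R => t * z ^+ 2) (2 * t * z).
Proof. by apply: is_derive_eq; rewrite /GRing.scale /=; ring. Qed.

Lemma is_derive_cos_phase t (z : R) :
  is_derive z 1 (fun z : R => cos (t * z ^+ 2)) (- (2 * t * z * sin (t * z ^+ 2))).
Proof.
have := @is_derive1_comp R cos (fun z => t * z ^+ 2) _ _ _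
  (is_derive_cos (t * z ^+ 2)) (is_derive_phase t z).
by move/is_derive_eq; apply; ring.
Qed.

Lemma is_derive_sin_phase t (z : R) :
  is_derive z 1 (fun z : R => sin (t * z ^+ 2)) (2 * t * z * cos (t * z ^+ 2)).
Proof.
have := @is_derive1_comp R sin (fun z => t * z ^+ 2) _ _ _
  (is_derive_sin (t * z ^+ 2)) (is_derive_phase t z).
by move/is_derive_eq; apply; ring.
Qed.

(** All nonzero components met below have the form k z^n cos (t z^2) or
k z^n sin (t z^2). *)
Lemma is_derive_monomialM (g : R -> R) k n (z dg : R) : is_derive z 1 g dg ->
  is_derive z 1 (fun z : R => k * z ^+ n * g z)
    (k * z ^+ n * dg + k * n%:R * z ^+ n.-1 * g z).
Proof.
move=> Dg.
have Dm : is_derive z 1 (fun z : R => k * z ^+ n) (k * n%:R * z ^+ n.-1).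
  have Dn : is_derive z 1 (fun z : R => z ^+ n) (n%:R * z ^+ n.-1).
    by apply: DeriveDef; [exact: exprn_derivable | rewrite exp_derive; exact: mulr1].
  apply: (is_derive_eq (is_deriveZ k Dn)).
  by rewrite /GRing.scale /=; ring.
apply: (is_derive_eq (is_deriveM Dm Dg)).
by rewrite /GRing.scale /=; ring.
Qed.

Lemma nabla_sigma t p v : H3 R p ->
  nabla (sigma t) p v =
  pt (- (2 * t * coordz p ^+ 2 * sin (t * coordz p ^+ 2)) * v ord0 iz,
      2 * t * coordz p ^+ 2 * cos (t * coordz p ^+ 2) * v ord0 iz,
      v ord0 ix * cos (t * coordz p ^+ 2) + v ord0 iy * sin (t * coordz p ^+ 2)).
Proof.
move=> pH; have z0 : coordz p != 0 by rewrite gt_eqF.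
have -> : sigma t = zfield (fun z => 1 * z ^+ 1 * cos (t * z ^+ 2))
                           (fun z => 1 * z ^+ 1 * sin (t * z ^+ 2)) (cst 0).
  by apply/funext => q; rewrite sigmaE /zfield /= !mul1r !expr1.
rewrite (nabla_zfield _ pH (is_derive_monomialM _ _ (is_derive_cos_phase _ _))
  (is_derive_monomialM _ _ (is_derive_sin_phase _ _)) (is_derive_cst _ _ _)).
by congr (pt (_, _, _)); rewrite /cst /=; field.
Qed.

Lemma bending_sigma t p : H3 R p -> bending (sigma t) p = 1 + 4 * t ^+ 2 * coordz p ^+ 4.
Proof.
move=> pH; have z0 : coordz p != 0 by rewrite gt_eqF.
rewrite /bending sum3 !innerE !nabla_sigma // xi_x xi_y xi_z !ptE.
have cs := cos2Dsin2 (t * coordz p ^+ 2).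
transitivity ((cos (t * coordz p ^+ 2) ^+ 2 + sin (t * coordz p ^+ 2) ^+ 2)
              * (1 + 4 * t ^+ 2 * coordz p ^+ 4)); last by rewrite cs mul1r.
by field.
Qed.

Lemma nabla_xi_x p v : H3 R p -> nabla (xi ix) p v = pt (0, 0, v ord0 ix).
Proof.
move=> pH; have z0 : coordz p != 0 by rewrite gt_eqF.
have -> : xi ix = zfield id (cst 0) (cst 0) by apply/funext => q; rewrite xi_x.
rewrite (nabla_zfield _ pH (is_derive_id _ _) (is_derive_cst _ _ _) (is_derive_cst _ _ _)).
by congr (pt (_, _, _)); rewrite /cst /=; field.
Qed.

Lemma nabla_xi_y p v : H3 R p -> nabla (xi iy) p v = pt (0, 0, v ord0 iy).
Proof.
move=> pH; have z0 : coordz p != 0 by rewrite gt_eqF.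
have -> : xi iy = zfield (cst 0) id (cst 0) by apply/funext => q; rewrite xi_y.
rewrite (nabla_zfield _ pH (is_derive_cst _ _ _) (is_derive_id _ _) (is_derive_cst _ _ _)).
by congr (pt (_, _, _)); rewrite /cst /=; field.
Qed.

Lemma nabla_xi_z p v : H3 R p -> nabla (xi iz) p v = pt (- v ord0 ix, - v ord0 iy, 0).
Proof.
move=> pH; have z0 : coordz p != 0 by rewrite gt_eqF.
have -> : xi iz = zfield (cst 0) (cst 0) id by apply/funext => q; rewrite xi_z.
rewrite (nabla_zfield _ pH (is_derive_cst _ _ _) (is_derive_cst _ _ _) (is_derive_id _ _)).
by congr (pt (_, _, _)); rewrite /cst /=; field.
Qed.

Lemma nabla_near_zfield (F : E -> E) (a b c : R -> R) p : H3 R p ->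
  (forall q, H3 R q -> F q = zfield a b c q) -> forall v,
  nabla F p v = nabla (zfield a b c) p v.
Proof.
by move=> pH FE v; apply: near_eq_nabla; apply: filterS (near_H3 pH) => q; exact: FE.
Qed.

Lemma rough_laplacian_sigma t p : H3 R p ->
  rough_laplacian (sigma t) p = (1 + 4 * t ^+ 2 * coordz p ^+ 4) *: sigma t p.
Proof.
move=> pH; have z0 : coordz p != 0 by rewrite gt_eqF.
rewrite /rough_laplacian sum3 /nabla2.
rewrite nabla_xi_x // nabla_xi_y // nabla_xi_z //.
have Dc k n := is_derive_monomialM k n (is_derive_cos_phase t (coordz p)).
have Ds k n := is_derive_monomialM k n (is_derive_sin_phase t (coordz p)).
have D0 := is_derive_cst (0 : R) (coordz p) 1.
(* The first covariant derivatives along the frame, as functions of the point: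
   they are again fields that only depend on the height. *)
have Ex q : H3 R q -> nabla (sigma t) q (xi ix q) =
    zfield (cst 0) (cst 0) (fun z => 1 * z ^+ 1 * cos (t * z ^+ 2)) q.
  by move=> qH; rewrite nabla_sigma // xi_x !ptE /zfield; congr (pt (_, _, _));
    rewrite /cst /=; ring.
have Ey q : H3 R q -> nabla (sigma t) q (xi iy q) =
    zfield (cst 0) (cst 0) (fun z => 1 * z ^+ 1 * sin (t * z ^+ 2)) q.
  by move=> qH; rewrite nabla_sigma // xi_y !ptE /zfield; congr (pt (_, _, _));
    rewrite /cst /=; ring.
have Ez q : H3 R q -> nabla (sigma t) q (xi iz q) =
    zfield (fun z => - (2 * t) * z ^+ 3 * sin (t * z ^+ 2))
           (fun z => 2 * t * z ^+ 3 * cos (t * z ^+ 2)) (cst 0) q.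
  by move=> qH; rewrite nabla_sigma // xi_z !ptE /zfield; congr (pt (_, _, _));
    rewrite /cst /=; ring.
rewrite (nabla_near_zfield pH Ex) (nabla_near_zfield pH Ey).
rewrite (nabla_near_zfield pH Ez).
rewrite (nabla_zfield _ pH D0 D0 (Dc _ _)) (nabla_zfield _ pH D0 D0 (Ds _ _)).
rewrite (nabla_zfield _ pH (Ds _ _) (Dc _ _) D0) !nabla_sigma // sigmaE.
rewrite xi_x xi_y xi_z !ptE /cst /=.
apply/rowP; apply: ord3_ind; do !rewrite [in LHS]mxE;
  by rewrite [in RHS]mxE !ptE ?mxE /=; field.
Qed.

End Sigma.

(** * Bending of horospherical unit fields *)

Section Horospherical.
Context {R : realType}.
Local Notation E := 'rV[R]_3.
Implicit Types (p v w : E) (s : E -> E) (t : R) (U : set E).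

Lemma sigma_family_smooth (V : normedModType R) (A : set V) (T : V -> R) (P : V -> E) :
  open A -> smooth_on A T -> smooth_on A (fun q => coordz (P q)) ->
  smooth_on A (fun q => sigma (T q) (P q)).
Proof.
move=> oA sT sZ.
have sph : smooth_on A (fun q => T q * coordz (P q) ^+ 2).
  rewrite (_ : (fun _ => _) = fun q => T q * (coordz (P q) * coordz (P q))).
    by apply: smoothM => //; exact: smoothM.
  by apply/funext => q; rewrite expr2.
rewrite (_ : (fun _ => _) = fun q =>
   (cos (T q * coordz (P q) ^+ 2) * coordz (P q)) *: (delta_mx ord0 ix : E) +
   (sin (T q * coordz (P q) ^+ 2) * coordz (P q)) *: (delta_mx ord0 iy : E)).
  apply: smoothD => //; apply: smoothZl => //; apply: smoothM => //.
    exact: smooth_cos.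
  exact: smooth_sin.
by apply/funext => q; rewrite /sigma /xi !scalerA.
Qed.

Lemma sigma_jointly_smooth :
  smooth_on [set q : R * E | H3 R q.2] (fun q => sigma q.1 q.2).
Proof.
apply: sigma_family_smooth.
- apply: (@open_comp _ _ (@snd R E) (H3 R)); last exact: open_H3.
  by move=> q _; exact: cvg_snd.
- by apply: smooth_linear_fun => // q; exact: cvg_fst.
- apply: smooth_linear_fun => [a u v|q]; first by rewrite /coordz !mxE.
  apply: (@continuous_comp _ _ _ (@snd R E) (@coordz R)); first exact: cvg_snd.
  exact: coordz_continuous.
Qed.

Lemma sigma_smooth U t : open U -> smooth_on U (sigma t).
Proof.
move=> oU; apply: (@sigma_family_smooth _ _ (cst t) id) => //.
  exact: smooth_cst.
exact: coord_smooth.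
Qed.

Lemma sigma_unit t p : H3 R p -> inner p (sigma t p) (sigma t p) = 1.
Proof.
move=> pH; have z0 : coordz p != 0 by rewrite gt_eqF.
rewrite innerE sigmaE !ptE -[RHS](cos2Dsin2 (t * coordz p ^+ 2)).
by field.
Qed.

Lemma sigma_horospherical U t : open U -> U `<=` H3 R -> horospherical U (sigma t).
Proof.
move=> oU UH; split; first split; first exact: sigma_smooth.
  by move=> p /UH; exact: sigma_unit.
by move=> p _; rewrite sigmaE /coordz ptE.
Qed.

Lemma sigma_harmonic t : harmonic_unit_field (H3 R) (sigma t).
Proof.
split; first by have [] := sigma_horospherical t open_H3 (@subset_refl _ (H3 R)).
by move=> p pH; rewrite rough_laplacian_sigma // bending_sigma.
Qed.

(** For s = cos u xi_1 + sin u xi_2 this is |grad u|^2. It is written in terms of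
the coordinate components of s, through z d_i s_k - [i = z] s_k =
z^2 d_i (s_k / z), so that no angle function has to be chosen. *)
Definition twist s p : R := (coordz p ^+ 2)^-1 *
  \sum_i ((coordz p * partial i (fun q => s q ord0 ix) p - (i == iz)%:R * s p ord0 ix) ^+ 2
        + (coordz p * partial i (fun q => s q ord0 iy) p - (i == iz)%:R * s p ord0 iy) ^+ 2).

Lemma twist_ge0 s p : 0 <= twist s p.
Proof.
apply: mulr_ge0; first by rewrite invr_ge0 sqr_ge0.
by apply: sumr_ge0 => i _; rewrite addr_ge0 // sqr_ge0.
Qed.

Lemma horospherical_norm U s p : U `<=` H3 R -> horospherical U s -> U p ->
  s p ord0 ix ^+ 2 + s p ord0 iy ^+ 2 = coordz p ^+ 2.
Proof.
move=> UH [[_ us] hs] Up; have z0 : coordz p != 0 by rewrite gt_eqF //; exact: UH.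
have := us p Up; rewrite innerE [s p ord0 iz](hs p Up) mulr0 addr0.
by move=> /(congr1 (fun a => coordz p ^+ 2 * a)); rewrite mulr1 mulVKf ?expf_neq0 //.
Qed.

Lemma smooth_coord U s k : open U -> smooth_on U s -> smooth_on U (fun q => s q ord0 k).
Proof.
move=> oU ss.
pose fM := GRing.isLinear.Build _ _ _ _ _ (@coord_linear R k).
pose fL : {linear E -> R} := HB.pack (fun q : E => q ord0 k : R) fM.
exact: (smooth_linear_comp (L := fL) oU (@coord_continuous _ _ _ _ _) ss).
Qed.

(** The z-component of the derivative of s along xi_1, xi_2, xi_3 is s_x, s_y
and 0; the sum of their squares, divided by z^2, is the constant term 1. *)
Lemma bending_horospherical U s p : open U -> U `<=` H3 R -> horospherical U s ->
  U p -> bending s p = 1 + twist s p.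
Proof.
move=> oU UH hs Up; have pH := UH _ Up.
have z0 : coordz p != 0 by rewrite gt_eqF.
have [[ss us] sz] := hs.
have Dxi k (i : 'I_3) : 'D_(xi i p) (fun q => s q ord0 k) p =
    coordz p * partial i (fun q => s q ord0 k) p.
  have dk : differentiable (fun q => s q ord0 k) p.
    by have /smooth_on_diff := smooth_coord k oU ss; exact.
  by rewrite /partial !deriveE // /xi linearZ.
have Dz v : 'D_v (fun q => s q ord0 iz) p = 0.
  rewrite (@derive_eq_on _ _ _ U _ (cst 0) p v) ?derive_cst // => q.
  by rewrite inE; exact: sz.
have szp : s p ord0 iz = 0 by exact: sz.
have sxy := horospherical_norm UH hs Up.
rewrite /bending /twist !sum3 !innerE !nablaE // !Dz !Dxi !szp.
rewrite xi_x xi_y xi_z !ptE /=.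
set Xx := partial ix _ p; set Xy := partial ix _ p.
set Yx := partial iy _ p; set Yy := partial iy _ p.
set Zx := partial iz _ p; set Zy := partial iz _ p.
have h1 : (1 : R) = (coordz p ^+ 2)^-1 * (s p ord0 ix ^+ 2 + s p ord0 iy ^+ 2).
  by rewrite sxy mulVf // expf_neq0.
rewrite [X in _ = X + _]h1.
by field.
Qed.

Lemma twist_eq0 s p : H3 R p -> twist s p = 0 -> forall i,
  coordz p * partial i (fun q => s q ord0 ix) p = (i == iz)%:R * s p ord0 ix /\
  coordz p * partial i (fun q => s q ord0 iy) p = (i == iz)%:R * s p ord0 iy.
Proof.
move=> pH /eqP; rewrite mulf_eq0 invr_eq0 expf_eq0 /= gt_eqF //= => /eqP.
move=> /psumr_eq0P S0 i; have /eqP := S0 (fun i _ => addr_ge0 (sqr_ge0 _) (sqr_ge0 _)) i isT.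
by rewrite paddr_eq0 ?sqr_ge0 // !sqrf_eq0 !subr_eq0 => /andP[/eqP -> /eqP ->].
Qed.

End Horospherical.

(** * Symmetry of second derivatives *)

Section MixedDerivatives.
Context {R : realType} {V : normedModType R}.
Implicit Types (A : set V) (f g : V -> R) (p q v w : V).

Lemma is_derive_line {W : normedModType R} (g : V -> W) q v (a : R) :
  differentiable g (q + a *: v) ->
  is_derive a 1 (fun b : R => g (q + b *: v)) ('D_v g (q + a *: v)).
Proof.
move=> dg; pose l (b : R) := q + b *: v.
have dl : is_diff a l (0 + *:%R ^~ v) by exact: is_diffD.
have dgl : differentiable (g \o l) a by exact: differentiable_comp.
apply: DeriveDef; first exact/derivable1_diffP.
rewrite -/(g \o l) !deriveE // diff_comp // diff_val /=.
by rewrite add0r scale1r.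
Qed.

Lemma mvt_line g q v (h : R) : 0 < h ->
  (forall a, 0 <= a <= h -> differentiable g (q + a *: v)) ->
  exists2 a, 0 <= a <= h & g (q + h *: v) - g q = 'D_v g (q + a *: v) * h.
Proof.
move=> h0 dg.
have dl a : 0 <= a <= h ->
    is_derive a 1 (fun b : R => g (q + b *: v)) ('D_v g (q + a *: v)).
  by move=> ah; apply: is_derive_line; exact: dg.
have [a|c|a aI] := @MVT _ (fun b => g (q + b *: v)) (fun a => 'D_v g (q + a *: v)) 0 h h0.
- by rewrite in_itv /= => /andP[a0 ah]; apply: dl; rewrite !ltW.
- apply: derivable_within_continuous => b; rewrite in_itv /= => bI.
  by case: (dl b bI).
rewrite scale0r addr0 subr0 => ->; exists a => //.
by move: aI; rewrite in_itv /= => /andP[a0 ah]; rewrite !ltW.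
Qed.

(** Two applications of the mean value theorem: first along v, to the difference
of f over a step h along w, and then along w, to the derivative of f along v. *)
Lemma second_difference A f p v w (h : R) : smooth_on A f -> 0 < h ->
  (forall a b, 0 <= a <= h -> 0 <= b <= h -> A (p + a *: v + b *: w)) ->
  exists2 q, exists a b, [/\ 0 <= a <= h, 0 <= b <= h & q = p + a *: v + b *: w] &
    f (p + h *: v + h *: w) - f (p + h *: v) - (f (p + h *: w) - f p) =
    'D_w ('D_v f) q * (h * h).
Proof.
move=> sf h0 boxA.
pose g q := f (q + h *: w) - f q.
have hh : 0 <= h <= h by apply/andP; split=> //; exact: ltW.
have zh : 0 <= (0 : R) <= h by rewrite lexx ltW.
have df a b : 0 <= a <= h -> 0 <= b <= h -> differentiable f (p + a *: v + b *: w).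
  by move=> ah bh; apply: smooth_on_diff sf _; exact: boxA.
have dsh q : is_diff q (fun q => q + h *: w) (id + 0) by exact: is_diffD.
have dfh a : 0 <= a <= h -> differentiable (fun q => f (q + h *: w)) (p + a *: v).
  move=> ah; apply: (@differentiable_comp _ _ _ _ (fun q => q + h *: w) f) => //.
  exact: df.
have dg a : 0 <= a <= h -> differentiable g (p + a *: v).
  move=> ah; apply: differentiableB; first exact: dfh.
  by have := df a 0 ah zh; rewrite scale0r addr0.
have [a ah gE] := mvt_line h0 dg.
have DgE : 'D_v g (p + a *: v) = 'D_v f (p + a *: v + h *: w) - 'D_v f (p + a *: v).
  have dfa : differentiable f (p + a *: v).
    by have := df a 0 ah zh; rewrite scale0r addr0.
  have -> : 'D_v g (p + a *: v) =
    'D_v (fun q => f (q + h *: w)) (p + a *: v) - 'D_v f (p + a *: v).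
    by apply: deriveB; apply: diff_derivable => //; exact: dfh.
  congr (_ - _); rewrite !deriveE; [|exact: df|exact: dfh].
  rewrite -/(f \o (fun q => q + h *: w)) diff_comp //=; last exact: df.
  by rewrite diff_val /= addr0.
have [|b bh DE] := @mvt_line ('D_v f) (p + a *: v) w h h0.
  move=> b bh; apply: smooth_on_diff (smooth_on_derive _ sf) _; exact: boxA.
exists (p + a *: v + b *: w); first by exists a, b.
by rewrite mulrA -DE -DgE -gE /g [p + h *: v + h *: w]addrAC.
Qed.

Lemma dist_halves (x y z e : R) :
  `|x - z| < e / 2 -> `|y - z| < e / 2 -> `|x - y| <= e.
Proof.
move=> xz yz; have -> : x - y = (x - z) - (y - z) by rewrite opprB addrA subrK.
by rewrite (le_trans (ler_normB _ _)) // [e]splitr lerD // ltW.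
Qed.

(** The second difference is symmetric in v and w, so that the two mixed
derivatives agree at two points as close to p as desired; both are continuous at
p. *)
Lemma derive_derive_sym A f p v w : open A -> smooth_on A f -> A p ->
  'D_w ('D_v f) p = 'D_v ('D_w f) p.
Proof.
move=> oA sf Ap.
pose G := 'D_w ('D_v f); pose H := 'D_v ('D_w f); suff : G p = H p by [].
have sG : smooth_on A G by do 2 apply: smooth_on_derive.
have sH : smooth_on A H by do 2 apply: smooth_on_derive.
have cG : {for p, continuous G} by exact/differentiable_continuous/(smooth_on_diff sG).
have cH : {for p, continuous H} by exact/differentiable_continuous/(smooth_on_diff sH).
apply/eqP; rewrite -subr_eq0 -normr_le0; apply/ler_addgt0Pl => e e0.
have e20 : 0 < e / 2 by rewrite divr_gt0.
have nG : \forall q \near p, `|G p - G q| < e / 2.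
  by move/cvgrPdist_lt : cG; apply.
have nH : \forall q \near p, `|H p - H q| < e / 2.
  by move/cvgrPdist_lt : cH; apply.
have nA : \forall q \near p, A q by exact: open_nbhs_nbhs.
have /nbhs_ballP [r /= r0 rP] : nbhs p [set q | [/\ `|G p - G q| < e / 2,
    `|H p - H q| < e / 2 & A q]].
  by apply: filterS3 nG nH nA => q; split.
pose h := r / (`|v| + `|w| + 1).
have N0 : 0 < `|v| + `|w| + 1 by rewrite ltr_wpDl // addr_ge0.
have h0 : 0 < h by rewrite divr_gt0.
have small a b : 0 <= a <= h -> 0 <= b <= h -> ball p r (p + a *: v + b *: w).
  move=> /andP[a0 ah] /andP[b0 bh]; rewrite -ball_normE /ball_ /=.
  rewrite -addrA opprD addNKr normrN (le_lt_trans (ler_normD _ _)) // !normrZ.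
  rewrite (ger0_norm a0) (ger0_norm b0).
  have -> : r = h * (`|v| + `|w| + 1) by rewrite /h divfK // gt_eqF.
  rewrite (@le_lt_trans _ _ (h * (`|v| + `|w|))) // ?mulrDr ?lerD //.
  - by rewrite ler_wpM2r.
  - by rewrite ler_wpM2r.
  - by rewrite mulr1 ltrDl.
have boxA a b : 0 <= a <= h -> 0 <= b <= h -> A (p + a *: v + b *: w).
  by move=> ah bh; case: (rP _ (small a b ah bh)).
have [q1 [a [b [ah bh q1E]]] E1] := second_difference sf h0 boxA.
have [|q2 [a' [b' [ah' bh' q2E]]] E2] := @second_difference A f p w v h sf h0.
  by move=> a' b' ah' bh'; rewrite addrAC; exact: boxA.
have [G1 _ _] := rP _ (small a b ah bh).
have := small b' a' bh' ah'; rewrite addrAC => /rP [_ H1 _].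
rewrite -q1E in G1; rewrite -q2E in H1.
have hE : p + h *: w + h *: v = p + h *: v + h *: w by rewrite addrAC.
rewrite hE in E2.
have hh0 : h * h != 0 by rewrite mulf_neq0 ?gt_eqF.
have GH : G q1 = H q2.
  apply: (mulIf hh0).
  (* The left-hand sides of E1 and E2 are the same second difference. *)
  have swap (x y z u : R) : x - y - (z - u) = x - z - (y - u) by ring.
  exact: etrans (esym E1) (etrans (swap _ _ _ _) E2).
by rewrite addr0; apply: (dist_halves G1); rewrite GH.
Qed.

End MixedDerivatives.

(** * Isometries preserving [sigma t] *)

Section IsometryInvariance.
Context {R : realType}.
Local Notation E := 'rV[R]_3.
Implicit Types (p q v w : E) (t : R) (g : @hsp R -> @hsp R).

Lemma hvalP (p : @hsp R) : H3 R (hval p).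
Proof. exact: set_valP. Qed.

Lemma hval_surj q : H3 R q -> exists p : @hsp R, hval p = q.
Proof. by move=> qH; exists (SigSub (mem_set qH)). Qed.

Lemma extendE g (p : @hsp R) : extend g (hval p) = hval (g p).
Proof. by have /(congr1 (@^~ p)) := valLK (0 : E) (hval \o g). Qed.

(** The coefficients of dx and dy in the 1-form dual to [sigma t]. *)
Definition cof t (z : R) := cos (t * z ^+ 2) / z.
Definition sof t (z : R) := sin (t * z ^+ 2) / z.
Definition dcof t (z : R) := - 2 * t * sin (t * z ^+ 2) - cos (t * z ^+ 2) / z ^+ 2.
Definition dsof t (z : R) := 2 * t * cos (t * z ^+ 2) - sin (t * z ^+ 2) / z ^+ 2.

Lemma is_derive_divz (h : R -> R) (z dh : R) : z != 0 -> is_derive z 1 h dh ->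
  is_derive z 1 (fun z => h z / z) (dh / z - h z / z ^+ 2).
Proof.
move=> z0 Dh; have Dv := @is_deriveV R id z 1 1 z0 (is_derive_id z 1).
apply: (is_derive_eq (is_deriveM Dh Dv)).
by rewrite /GRing.scale /=; field.
Qed.

Lemma is_derive_cof t (z : R) : z != 0 -> is_derive z 1 (cof t) (dcof t z).
Proof.
move=> z0; apply: (is_derive_eq (is_derive_divz z0 (is_derive_cos_phase t z))).
by rewrite /dcof; field.
Qed.

Lemma is_derive_sof t (z : R) : z != 0 -> is_derive z 1 (sof t) (dsof t z).
Proof.
move=> z0; apply: (is_derive_eq (is_derive_divz z0 (is_derive_sin_phase t z))).
by rewrite /dsof; field.
Qed.

Lemma inner_sigma t q w : H3 R q ->
  inner q (sigma t q) w = cof t (coordz q) * w ord0 ix + sof t (coordz q) * w ord0 iy.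
Proof.
move=> qH; have z0 : coordz q != 0 by rewrite gt_eqF.
by rewrite innerE sigmaE !ptE /cof /sof; field.
Qed.

(** The exterior derivative of the 1-form dual to [sigma t], at a point of
height [z]. *)
Definition dform t (z : R) v w : R :=
  dcof t z * (v ord0 iz * w ord0 ix - w ord0 iz * v ord0 ix) +
  dsof t z * (v ord0 iz * w ord0 iy - w ord0 iz * v ord0 iy).

(** The derivative along v of the pulled back 1-form evaluated on the constant
field w. In the difference between this expression and the one with v and w
exchanged, the terms with second derivatives of f cancel. *)
Lemma derive_pullback (f : E -> E) t q v w : smooth_on (H3 R) f ->
  (forall q, H3 R q -> H3 R (f q)) -> H3 R q ->
  'D_v (fun q => cof t (coordz (f q)) * ('D_w f q) ord0 ix
               + sof t (coordz (f q)) * ('D_w f q) ord0 iy) q =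
  ('D_v f q) ord0 iz * (dcof t (coordz (f q)) * ('D_w f q) ord0 ix
                      + dsof t (coordz (f q)) * ('D_w f q) ord0 iy)
  + (cof t (coordz (f q)) * 'D_v ('D_w (fun q => f q ord0 ix)) q
   + sof t (coordz (f q)) * 'D_v ('D_w (fun q => f q ord0 iy)) q).
Proof.
move=> sf fH qH.
have fz0 : coordz (f q) != 0 by rewrite gt_eqF //; exact: fH.
have sk k : smooth_on (H3 R) (fun q => f q ord0 k) by apply: smooth_coord open_H3 sf.
have Dk k u r : H3 R r -> 'D_u (fun q => f q ord0 k) r = 'D_u f r ord0 k.
  move=> rH; rewrite derive_mx ?mxE //; apply: diff_derivable.
  exact: smooth_on_diff sf rH.
have dfz : differentiable (fun q => coordz (f q)) q by apply: smooth_on_diff (sk iz) qH.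
have sDk k : smooth_on (H3 R) (fun q => 'D_w f q ord0 k).
  by apply: smooth_coord open_H3 _; exact: smooth_on_derive.
have dDk k : differentiable (fun q => 'D_w f q ord0 k) q by exact: smooth_on_diff (sDk k) qH.
have DDk k : 'D_v (fun q => 'D_w f q ord0 k) q = 'D_v ('D_w (fun q => f q ord0 k)) q.
  apply: (derive_eq_on (A := H3 R)) => //; first exact: open_H3.
  by move=> r; rewrite inE => rH; rewrite Dk.
have [dc Dc] := derive_comp_real v dfz (is_derive_cof t fz0).
have [ds Ds] := derive_comp_real v dfz (is_derive_sof t fz0).
have -> : 'D_v (fun q => cof t (coordz (f q)) * ('D_w f q) ord0 ix
               + sof t (coordz (f q)) * ('D_w f q) ord0 iy) q =
  (cof t (coordz (f q)) * 'D_v (fun q => 'D_w f q ord0 ix) q +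
   'D_w f q ord0 ix * 'D_v (cof t \o (fun q => coordz (f q))) q) +
  (sof t (coordz (f q)) * 'D_v (fun q => 'D_w f q ord0 iy) q +
   'D_w f q ord0 iy * 'D_v (sof t \o (fun q => coordz (f q))) q).
  rewrite -[X in _ = X + _](deriveM (diff_derivable dc) (diff_derivable (dDk ix))).
  rewrite -[X in _ = _ + X](deriveM (diff_derivable ds) (diff_derivable (dDk iy))).
  apply: deriveD; apply: derivableM; apply: diff_derivable => //.
rewrite Dc Ds !DDk (Dk iz v q qH).
move: (derive (derive _ ^~ w) _ _) (derive (derive _ ^~ w) _ _) => Sx Sy.
move: (derive f q v) (derive f q w) (coordz (f q)) => a b z.
by ring.
Qed.

(** The pullback by f of the dual 1-form is that 1-form itself, so that the same
holds for its exterior derivative. *)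
Lemma dform_pullback (f : E -> E) t q v w : smooth_on (H3 R) f ->
  (forall q, H3 R q -> H3 R (f q)) ->
  (forall q u, H3 R q -> inner (f q) (sigma t (f q)) ('D_u f q) = inner q (sigma t q) u) ->
  H3 R q ->
  dform t (coordz (f q)) ('D_v f q) ('D_w f q) = dform t (coordz q) v w.
Proof.
move=> sf fH finv qH.
have z0 : coordz q != 0 by rewrite gt_eqF.
have Dinv u1 u2 : 'D_u1 (fun q => cof t (coordz (f q)) * ('D_u2 f q) ord0 ix
               + sof t (coordz (f q)) * ('D_u2 f q) ord0 iy) q =
    u1 ord0 iz * (dcof t (coordz q) * u2 ord0 ix + dsof t (coordz q) * u2 ord0 iy).
  rewrite (derive_eq_on (A := H3 R) (g := fun q => cof t (coordz q) * u2 ord0 ix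
               + sof t (coordz q) * u2 ord0 iy)) //; last 2 first.
  - exact: open_H3.
  - move=> r; rewrite inE => rH; rewrite -inner_sigma ?finv ?inner_sigma //.
    exact: fH.
  have Dh : is_derive (coordz q) 1 (fun z => cof t z * u2 ord0 ix + sof t z * u2 ord0 iy)
     (dcof t (coordz q) * u2 ord0 ix + dsof t (coordz q) * u2 ord0 iy).
    have Dx := is_deriveM (is_derive_cof t z0) (is_derive_cst (u2 ord0 ix) (coordz q) 1).
    have Dy := is_deriveM (is_derive_sof t z0) (is_derive_cst (u2 ord0 iy) (coordz q) 1).
    apply: (is_derive_eq (is_deriveD Dx Dy)).
    by rewrite /GRing.scale /=; ring.
  by rewrite (derive_zfun _ Dh) mulrC.
have := etrans (esym (derive_pullback t w v sf fH qH)) (Dinv w v).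
have := etrans (esym (derive_pullback t v w sf fH qH)) (Dinv v w).
have sk k : smooth_on (H3 R) (fun q => f q ord0 k) by apply: smooth_coord open_H3 sf.
rewrite (derive_derive_sym v w open_H3 (sk ix) qH) (derive_derive_sym v w open_H3 (sk iy) qH).
move: (derive (derive _ ^~ w) _ _) (derive (derive _ ^~ w) _ _) => Sx Sy.
move=> E1 E2; rewrite /dform.
have -> : forall c d : R, c * (v ord0 iz * w ord0 ix - w ord0 iz * v ord0 ix) +
  d * (v ord0 iz * w ord0 iy - w ord0 iz * v ord0 iy) =
  v ord0 iz * (c * w ord0 ix + d * w ord0 iy) - w ord0 iz * (c * v ord0 ix + d * v ord0 iy).
  by move=> c d; ring.
rewrite -E1 -E2; move: (derive f q v) (derive f q w) (coordz (f q)) => a b z.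
by ring.
Qed.

Lemma dform_sum t (z : R) v w : dform t z v w =
  \sum_i \sum_j v ord0 i * dform t z (delta_mx ord0 i) (delta_mx ord0 j) * w ord0 j.
Proof. by rewrite !sum3 /dform !mxE /=; ring. Qed.

(** Multiplied by the factor z^4 of the metric on 2-forms, this sum is twice the
squared norm of the exterior derivative. *)
Lemma dform_sqr t (z : R) : z != 0 ->
  \sum_i \sum_j dform t z (delta_mx ord0 i) (delta_mx ord0 j) ^+ 2 =
  2 * (1 + 4 * t ^+ 2 * z ^+ 4) / z ^+ 4.
Proof.
move=> z0; rewrite !sum3 /dform !mxE /=.
have cs := cos2Dsin2 (t * z ^+ 2).
transitivity (2 * (cos (t * z ^+ 2) ^+ 2 + sin (t * z ^+ 2) ^+ 2)
              * (1 + 4 * t ^+ 2 * z ^+ 4) / z ^+ 4); last by rewrite cs mulr1.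
by rewrite /dcof /dsof; field.
Qed.

(** If J scales squared lengths by l, so does its transpose, and the squared
Frobenius norm of a bilinear form gains a factor l for each of its two
arguments. *)
Lemma conformal_frobenius n (J B C : 'M[R]_n) (l : R) :
  J *m J^T = l%:M -> B = J *m C *m J^T -> \tr (B *m B^T) = l ^+ 2 * \tr (C *m C^T).
Proof.
move=> JJ ->.
have [l0|l0] := eqVneq l 0.
  have J0 : J = 0.
    apply/matrixP => i j; rewrite mxE; apply/eqP; rewrite -sqrf_eq0.
    have := congr1 (fun M : 'M[R]_n => M i i) JJ; rewrite l0 !mxE mul0rn => /eqP.
    rewrite psumr_eq0 => [/allP /(_ j)|k _]; last by rewrite mxE -expr2 sqr_ge0.
    by rewrite mem_index_enum mxE -expr2; apply.
  by rewrite J0 !mul0mx mxtrace0 l0 expr0n mul0r.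
have JJ' : J^T *m J = l%:M.
  have : J *m (l^-1 *: J^T) = 1%:M.
    by rewrite -scalemxAr JJ scale_scalar_mx mulVf.
  move=> /mulmx1C; rewrite -scalemxAl => /(congr1 (fun M => l *: M)).
  by rewrite scalerA divff // scale1r scale_scalar_mx mulr1.
rewrite !trmx_mul trmxK !mulmxA -[J *m C *m J^T *m J]mulmxA JJ' mul_mx_scalar.
rewrite -!scalemxAl mxtraceZ mxtrace_mulC !mulmxA JJ' mul_scalar_mx -scalemxAl mxtraceZ.
by rewrite mulrA expr2.
Qed.

Lemma coordz_invariant g t : t != 0 -> hyp_isometry g ->
  (forall p : @hsp R, 'd (extend g) (hval p) (sigma t (hval p)) = sigma t (hval (g p))) ->
  forall p : @hsp R, coordz (hval (g p)) = coordz (hval p).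
Proof.
move=> t0 [sf _ iso] inv p.
set f := extend g; set q := hval p.
have fH r : H3 R r -> H3 R (f r).
  by move=> /hval_surj [r' <-]; rewrite /f extendE; exact: hvalP.
have finv r u : H3 R r -> inner (f r) (sigma t (f r)) ('D_u f r) = inner r (sigma t r) u.
  move=> rH; have [r' r'E] := hval_surj rH.
  rewrite deriveE; last exact: smooth_on_diff sf rH.
  by rewrite -r'E /f extendE -inv iso.
have qH : H3 R q := hvalP p.
have zq0 : coordz q != 0 by rewrite gt_eqF.
have zf0 : coordz (f q) != 0 by rewrite gt_eqF //; exact: fH.
rewrite -extendE -/f -/q.
(* J is the matrix of the differential of g at p, acting on row vectors, and B
   is the matrix of the 2-form in the coordinate basis. *)
pose e i : E := delta_mx ord0 i.
pose J : 'M[R]_3 := \matrix_(i, k) ('D_(e i) f q) ord0 k.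
pose B (z : R) : 'M[R]_3 := \matrix_(i, j) dform t z (e i) (e j).
have JJ : J *m J^T = ((coordz (f q) / coordz q) ^+ 2)%:M.
  apply/matrixP => i j; rewrite !mxE.
  have dfq : differentiable f q by exact: smooth_on_diff sf qH.
  have := iso p (e i) (e j); rewrite -extendE -/f -/q -!deriveE // !innerE.
  move=> /(congr1 (fun a => coordz (f q) ^+ 2 * a)).
  rewrite mulrA divff ?expf_neq0 // mul1r sum3 !mxE => ->.
  by move: i j; do 2 apply: ord3_ind; rewrite /= ?mulr1n ?mulr0n; field.
have BJ : B (coordz q) = J *m B (coordz (f q)) *m J^T.
  apply/matrixP => i j; rewrite mxE -(dform_pullback _ _ sf fH finv qH) dform_sum.
  rewrite mxE exchange_big /=; apply: eq_bigr => l _; rewrite !mxE mulr_suml.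
  by apply: eq_bigr => k _; rewrite !mxE.
have trB z : z != 0 -> \tr (B z *m (B z)^T) = 2 * (1 + 4 * t ^+ 2 * z ^+ 4) / z ^+ 4.
  move=> z0; rewrite -dform_sqr //; apply: eq_bigr => i _; rewrite mxE.
  by apply: eq_bigr => j _; rewrite !mxE expr2.
have := conformal_frobenius JJ BJ; rewrite !trB //.
move=> /(congr1 (fun a => a * coordz q ^+ 4 / 2)).
rewrite divfK ?expf_neq0 // => E1.
have : 1 + 4 * t ^+ 2 * coordz q ^+ 4 = 1 + 4 * t ^+ 2 * coordz (f q) ^+ 4.
  transitivity (2 * (1 + 4 * t ^+ 2 * coordz q ^+ 4) / 2); first by field.
  by rewrite E1; field; rewrite ?zq0 ?zf0.
move=> /addrI /mulfI; rewrite mulf_neq0 ?expf_neq0 ?pnatr_eq0 // => /(_ isT) z4.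
by apply/esym/eqP; rewrite -(@eqrXn2 _ 4) ?z4 // ltW //; exact: fH.
Qed.

(** The height is continuous and constant on the orbits, so that it defines a
continuous function on the quotient; a maximum c of it contradicts the existence
of points of height c + 1. *)
Lemma no_cocompact_invariance t (G : @isom_subgroup R) : t != 0 ->
  compact_quotient G -> ~ invariant_under G (sigma t).
Proof.
move=> t0 cG inv.
pose Q := quotient_topology {eq_quot (orbit_equiv G)}%qT.
pose z (p : @hsp R) : R := coordz (hval p).
have cz : continuous z.
  move=> p; apply: continuous_comp; first exact: initial_continuous.
  exact: coordz_continuous.
have zinv : {homo z : a b / (\pi_Q a == \pi_Q b)%qT >-> a == b}.
  move=> a b /eqP /eqquotP /asboolP [g Gg <-].
  by rewrite /z (coordz_invariant t0 (isoms_isometry Gg)) //; exact: inv.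
have cf : continuous (z \o repr : Q -> R) := repr_comp_continuous cz zinv.
have zrepr (p : @hsp R) : z (repr (\pi_Q p)%qT) = z p by apply/eqP/zinv; rewrite reprK.
have [p0 _] : exists p0 : @hsp R, hval p0 = pt (0, 0, 1).
  by apply: hval_surj; rewrite /H3 /coordz /= ptE.
have Q0 : [set: Q] !=set0 by exists (\pi_Q p0)%qT.
have cfT : {within [set: Q], continuous (z \o repr)} by exact: continuous_subspaceT.
have [c _ cmax] := compact_EVT_max Q0 cG cfT.
have [p1 p1E] : exists p1 : @hsp R, hval p1 = pt (0, 0, z (repr c) + 1).
  apply: hval_surj; rewrite /H3 /coordz /= ptE.
  by rewrite addr_gt0 //; exact: hvalP.
have := cmax (\pi_Q p1)%qT; rewrite inE /= => /(_ I).
by rewrite zrepr {1}/z p1E /coordz ptE gerDl ler10.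
Qed.

End IsometryInvariance.

(** * Open sets and Lebesgue measure in three-dimensional space *)

Section LebesgueSpace.
Context {R : realType}.
Local Notation M := (measurableTypeR R).
Local Notation T := (R * R * R)%type.
Local Notation MT := (M * M * M)%type.
Implicit Types (A : set T) (q : T).

Definition box3 (a b c d e f : R) : set T := (`]a, b[ `*` `]c, d[) `*` `]e, f[.

Lemma measurable_box3 (a b c d e f : R) : measurable (box3 a b c d e f : set MT).
Proof. by apply: measurableX; [apply: measurableX|]; exact: measurable_itv. Qed.

Lemma ball_box3 q (r : R) (x : T) :
  box3 (q.1.1 - r) (q.1.1 + r) (q.1.2 - r) (q.1.2 + r) (q.2 - r) (q.2 + r) x ->
  ball q r x.
Proof.
move=> [[/=]]; rewrite !in_itv /= => h1 h2 h3.
by split; [split|]; rewrite /ball /= ltr_distlC.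
Qed.

Lemma lebesgue3_box (a b c d e f : R) : a < b -> c < d -> e < f ->
  lebesgue3 (box3 a b c d e f : set MT) = ((b - a) * (d - c) * (f - e))%:E.
Proof.
move=> ab cd ef.
have m1 : measurable (`]a, b[%classic : set M) by exact: measurable_itv.
have m2 : measurable (`]c, d[%classic : set M) by exact: measurable_itv.
have m3 : measurable (`]e, f[%classic : set M) by exact: measurable_itv.
pose l := @lebesgue_measure R.
rewrite [LHS](product_measure1E (l \x l)%E l (measurableX m1 m2) m3).
rewrite [X in (X * _)%E](product_measure1E l l m1 m2) !EFinM.
have lE (x y : R) : x < y -> l `]x, y[%classic = (y - x)%:E.
  by move=> xy; rewrite /l lebesgue_measure_itv /= lte_fin xy.
by congr ((_ * _) * _)%E; exact: lE.
Qed.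

Lemma open_box3 A q : open A -> A q -> exists a b c d e f : rat,
  box3 (ratr a) (ratr b) (ratr c) (ratr d) (ratr e) (ratr f) q /\
  box3 (ratr a) (ratr b) (ratr c) (ratr d) (ratr e) (ratr f) `<=` A.
Proof.
move=> oA Aq; have : nbhs q A by exact: open_nbhs_nbhs.
move=> /nbhs_ballP [r /= r0 rA].
have bracket (x : R) : exists a b : rat, x - r < ratr a < x /\ x < ratr b < x + r.
  have [|a] := @rat_in_itvoo R (x - r) x; first by rewrite gtrBl.
  have [|b] := @rat_in_itvoo R x (x + r); first by rewrite ltrDl.
  by rewrite !in_itv /= => hb ha; exists a, b.
have [a [b [/andP[a1 a2] /andP[b1 b2]]]] := bracket q.1.1.
have [c [d [/andP[c1 c2] /andP[d1 d2]]]] := bracket q.1.2.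
have [e [f [/andP[e1 e2] /andP[f1 f2]]]] := bracket q.2.
exists a, b, c, d, e, f; split.
  by split; [split|]; rewrite /= in_itv /= ?a2 ?b1 ?c2 ?d1 ?e2 ?f1.
move=> x [[/=]]; rewrite !in_itv /= => /andP[x1 x2] /andP[y1 y2] /andP[z1 z2].
apply/rA/ball_box3; split; [split|]; rewrite /= in_itv /=.
- by rewrite (lt_trans a1 x1) (lt_trans x2 b2).
- by rewrite (lt_trans c1 y1) (lt_trans y2 d2).
- by rewrite (lt_trans e1 z1) (lt_trans z2 f2).
Qed.

(** The measurable sets are those of the product of three Borel sigma-algebras;
an open set belongs to it as a countable union of boxes with rational
vertices. *)
Lemma open_measurable3 A : open A -> measurable (A : set MT).
Proof.
move=> oA.
pose I : countType := (rat * rat * rat * rat * rat * rat)%type.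
pose B (i : I) : set T := let: (a, b, c, d, e, f) := i in
  box3 (ratr a) (ratr b) (ratr c) (ratr d) (ratr e) (ratr f).
pose F (i : I) : set MT := if `[< B i `<=` A >] then B i else set0.
have -> : A = \bigcup_i F i.
  apply/seteqP; split=> [q Aq|q [i _]]; last first.
    by rewrite /F; case: asboolP => // BA; exact: BA.
  have [a [b [c [d [e [f [Bq BA]]]]]]] := open_box3 oA Aq.
  by exists (a, b, c, d, e, f) => //; rewrite /F; case: asboolP.
apply: countable_bigcupT_measurable; first exact: countableP.
move=> i; rewrite /F; case: asboolP => _; last exact: measurable0.
by move: i => [[[[[a b] c] d] e] f]; exact: measurable_box3.
Qed.

Lemma open_lebesgue3_gt0 A q : open A -> A q -> (0 < lebesgue3 (A : set MT))%E.
Proof.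
move=> oA Aq; have [a [b [c [d [e [f [Bq BA]]]]]]] := open_box3 oA Aq.
pose B := box3 (ratr a) (ratr b) (ratr c) (ratr d) (ratr e) (ratr f : R).
apply: (@lt_le_trans _ _ (lebesgue3 (B : set MT))).
  move: Bq => [[/=]]; rewrite !in_itv /= => /andP[x1 x2] /andP[y1 y2] /andP[z1 z2].
  rewrite lebesgue3_box ?lte_fin ?mulr_gt0 ?subr_gt0 //; first exact: lt_trans x1 x2.
  - exact: lt_trans y1 y2.
  - exact: lt_trans z1 z2.
  - exact: lt_trans x1 x2.
  - exact: lt_trans y1 y2.
  - exact: lt_trans z1 z2.
by apply: le_measure => //; rewrite inE; [exact: measurable_box3|exact: open_measurable3].
Qed.

Lemma open_continuous_measurable3 A (f : T -> R) : open A ->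
  {in A, continuous f} -> measurable_fun (A : set MT) (f : MT -> M).
Proof.
move=> oA cf; apply: (measurability _ (RGenOpens.measurableE R)).
move=> _ [_ [a [b ->] <-]]; apply: open_measurable3.
rewrite openE => q [Aq fq]; apply: filterI; first exact: open_nbhs_nbhs.
apply: cf; first by rewrite inE.
by apply: open_nbhs_nbhs; split => //; exact: interval_open.
Qed.

Lemma open_continuous_emeasurable3 A (f : T -> R) : open A ->
  {in A, continuous f} -> measurable_fun (A : set MT) ((fun q => (f q)%:E) : MT -> \bar R).
Proof.
by move=> oA cf; apply/measurable_EFinP; exact: open_continuous_measurable3.
Qed.

Lemma ae0_open_eq0 A (f : T -> R) : open A -> {in A, continuous f} ->
  ae_eq (lebesgue3 : {measure set MT -> \bar R}) (A : set MT) (EFin \o f) (cst 0%E) ->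
  forall q, A q -> f q = 0.
Proof.
move=> oA cf [N [mN N0 AN]] q Aq; apply/eqP/negPn/negP => fq.
pose B := A `&` f @^-1` [set y | y != 0].
have oB : open B.
  rewrite openE => x [Ax fx]; apply: filterI; first exact: open_nbhs_nbhs.
  apply: cf; first by rewrite inE.
  by apply: open_nbhs_nbhs; split => //; exact: open_neq.
have := open_lebesgue3_gt0 oB (conj Aq fq).
rewrite lt_neqAle eq_sym => /andP[/eqP B0 _]; apply: B0.
apply: (subset_measure0 _ mN _ N0); first exact: open_measurable3.
apply: subset_trans AN => x [Ax /= fx] /= /(_ Ax) [] fx0.
by rewrite fx0 eqxx in fx.
Qed.

End LebesgueSpace.

(** * Functions with zero derivative on a connected open set *)

Section LocallyConstant.
Context {R : realType} {V : normedModType R}.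
Implicit Types (U : set V) (f : V -> R).

Lemma near_const_of_derive0 U f p : open U -> (forall q, U q -> differentiable f q) ->
  (forall q v, U q -> 'D_v f q = 0) -> U p -> \forall q \near p, f q = f p.
Proof.
move=> oU df Df Up; have : nbhs p U by exact: open_nbhs_nbhs.
move=> /nbhs_ballP [r /= r0 rU]; apply/nbhs_ballP; exists r => // q pq.
have segU a : 0 <= a <= 1 -> U (p + a *: (q - p)).
  move=> /andP[a0 a1]; apply: rU; rewrite -ball_normE /ball_ /= opprD addNKr normrN.
  move: pq; rewrite -ball_normE /ball_ /= distrC => pq.
  by rewrite normrZ ger0_norm // (le_lt_trans _ pq) // ler_piMl.
have [a a01|a a01] := @mvt_line _ _ f p (q - p) 1 ltr01; first exact/df/segU.
rewrite Df ?mul0r; last exact: segU.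
by rewrite scale1r [p + _]addrC subrK => /eqP; rewrite subr_eq0 => /eqP.
Qed.

Lemma const_of_derive0 U f : open U -> connected U ->
  (forall q, U q -> differentiable f q) ->
  (forall q v, U q -> 'D_v f q = 0) -> forall p q, U p -> U q -> f q = f p.
Proof.
move=> oU cU df Df p q Up Uq.
have openB (P : set R) : open (U `&` f @^-1` P).
  rewrite openE => x [Ux fx]; have nU : nbhs x U by exact: open_nbhs_nbhs.
  apply: filterS2 nU (near_const_of_derive0 oU df Df Ux) => y Uy /= fy.
  by split=> //=; rewrite fy.
have BU : U `&` f @^-1` [set f p] = U.
  apply: cU; first by exists p.
  - by exists (U `&` f @^-1` [set f p]) => //; rewrite setIA setIid.
  - exists (~` (U `&` f @^-1` [set~ f p])); first exact: open_closedC.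
    apply/seteqP; split=> x [Ux fx]; split=> //.
      by move=> [_ /= nfx].
    by have [//|nfx] := pselect (f x = f p); case: fx; split.
by move: Uq; rewrite -{1}BU => -[].
Qed.

End LocallyConstant.

(** * The energy of horospherical unit fields *)

Section Energy.
Context {R : realType}.
Local Notation E := 'rV[R]_3.
Local Notation M := (measurableTypeR R).
Local Notation T := (R * R * R)%type.
Local Notation MT := (M * M * M)%type.
Implicit Types (p q v w : E) (s : E -> E) (t : R) (U : set E).

(** The vanishing of [twist] says that s_x / z and s_y / z, the coefficients of s
on xi_1 and xi_2, have zero derivatives. *)
Lemma twist0_invariant U s : open U -> connected U -> U `<=` H3 R ->
  horospherical U s -> (forall p, U p -> twist s p = 0) ->
  invariant_horospherical U s.
Proof.
move=> oU cU UH hs tw0; split=> //.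
have ss : smooth_on U s by case: hs => [[]].
have sk k : smooth_on U (fun q => s q ord0 k) by exact: smooth_coord.
have dk k p : U p -> differentiable (fun q => s q ord0 k) p.
  by move=> Up; exact: smooth_on_diff (sk k) Up.
have inv_der p : U p -> is_derive (coordz p) 1 GRing.inv (- (coordz p ^+ 2)^-1).
  move=> Up; have z0 : coordz p != 0 by rewrite gt_eqF //; exact: UH.
  have Dv := @is_deriveV R id (coordz p) 1 1 z0 (is_derive_id _ _).
  by apply: (is_derive_eq Dv); rewrite /GRing.scale /= mulr1.
have dz p : differentiable (@coordz R) p by exact: differentiable_coord.
have main k : (k == ix) || (k == iy) ->
    forall p q, U p -> U q -> s q ord0 k * (coordz q)^-1 = s p ord0 k * (coordz p)^-1.
  move=> kxy.
  have Fd p : U p -> differentiable (fun q => s q ord0 k * (coordz q)^-1) p.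
    move=> Up; apply: differentiableM; first exact: dk.
    by have [] := derive_comp_real 0 (dz p) (inv_der p Up).
  apply: const_of_derive0 => // p v Up.
  have pH := UH _ Up; have z0 : coordz p != 0 by rewrite gt_eqF.
  have basis i : 'D_(delta_mx ord0 i) (fun q => s q ord0 k * (coordz q)^-1) p = 0.
    have [di Di] := derive_comp_real (delta_mx ord0 i) (dz p) (inv_der p Up).
    have -> : 'D_(delta_mx ord0 i) (fun q => s q ord0 k * (coordz q)^-1) p =
       s p ord0 k * 'D_(delta_mx ord0 i) (GRing.inv \o (@coordz R)) p +
       (coordz p)^-1 * 'D_(delta_mx ord0 i) (fun q => s q ord0 k) p.
      by apply: (deriveM (diff_derivable (dk k p Up)) (diff_derivable di)).
    rewrite Di derive_coord -/(partial i _ p).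
    have tw : coordz p * partial i (fun q => s q ord0 k) p = (i == iz)%:R * s p ord0 k.
      have [tx ty] := twist_eq0 pH (tw0 p Up) i.
      by case/orP: kxy => /eqP ->.
    have -> : partial i (fun q => s q ord0 k) p = (i == iz)%:R * s p ord0 k / coordz p.
      by rewrite -tw mulrC mulKf.
    by rewrite mxE eqxx /= [iz == i]eq_sym; field.
  rewrite deriveE; last exact: Fd.
  rewrite (row_sum_delta v) linear_sum big1 // => i _; rewrite linearZ /=.
  by rewrite -deriveE ?basis ?scaler0 //; exact: Fd.
have [->|/set0P [p0 Up0]] := eqVneq U set0; first by exists 0, 0.
exists (s p0 ord0 ix * (coordz p0)^-1), (s p0 ord0 iy * (coordz p0)^-1) => p Up.
have z0 : coordz p != 0 by rewrite gt_eqF //; exact: UH.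
rewrite -(main ix isT p0 p Up0 Up) -(main iy isT p0 p Up0 Up) xi_x xi_y.
have szp : s p ord0 iz = 0 by case: hs => _; exact.
apply/rowP; apply: ord3_ind; rewrite mxE !(mxE _ _ ord0) /=.
- by rewrite mulr0 addr0 divfK.
- by rewrite mulr0 add0r divfK.
- by rewrite szp !mulr0 addr0.
Qed.

Lemma invariant_twist0 U s p : open U -> U `<=` H3 R ->
  invariant_horospherical U s -> U p -> twist s p = 0.
Proof.
move=> oU UH [hs [a [b sE]]] Up.
have sx q : U q -> s q ord0 ix = a * coordz q.
  by move=> /sE ->; rewrite xi_x xi_y mxE !(mxE _ _ ord0) /= mulr0 addr0.
have sy q : U q -> s q ord0 iy = b * coordz q.
  by move=> /sE ->; rewrite xi_x xi_y mxE !(mxE _ _ ord0) /= mulr0 add0r.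
have dl (c : R) i : partial i (fun q => c * coordz q) p = c * (i == iz)%:R.
  rewrite /partial.
  have -> : 'D_(delta_mx ord0 i) (fun q => c * coordz q) p =
      c *: 'D_(delta_mx ord0 i) (@coordz R) p.
    by apply: deriveZ; apply: diff_derivable; exact: differentiable_coord.
  by rewrite derive_coord mxE eqxx /= eq_sym.
have px i : partial i (fun q => s q ord0 ix) p = a * (i == iz)%:R.
  rewrite -dl /partial; apply: (derive_eq_on (A := U)) => // q; rewrite inE; exact: sx.
have py i : partial i (fun q => s q ord0 iy) p = b * (i == iz)%:R.
  rewrite -dl /partial; apply: (derive_eq_on (A := U)) => // q; rewrite inE; exact: sy.
rewrite /twist big1 ?mulr0 // => i _; rewrite px py sx // sy //.
have cancel_term (c d z : R) : z * (c * d) - d * (c * z) = 0 by ring.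
by rewrite !cancel_term expr0n addr0.
Qed.

(** Only used for the continuity of [twist]. *)
Lemma differentiable_twist U s p : open U -> U `<=` H3 R -> smooth_on U s -> U p ->
  differentiable (twist s) p.
Proof.
move=> oU UH ss Up.
have z0 : coordz p != 0 by rewrite gt_eqF //; exact: UH.
have dz : differentiable (@coordz R) p by exact: differentiable_coord.
have sk k : smooth_on U (fun q => s q ord0 k) by exact: smooth_coord.
have dterm k i : differentiable (fun p => coordz p * partial i (fun q => s q ord0 k) p
    - (i == iz)%:R * s p ord0 k) p.
  apply: differentiableB.
    apply: differentiableM => //.
    exact: smooth_on_diff (smooth_on_derive _ (sk k)) Up.
  apply: differentiableM; first exact: differentiable_cst.
  exact: smooth_on_diff (sk k) Up.
have dsq k i : differentiable (fun p => (coordz p * partial i (fun q => s q ord0 k) p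
    - (i == iz)%:R * s p ord0 k) ^+ 2) p.
  have -> : (fun p => (coordz p * partial i (fun q => s q ord0 k) p
    - (i == iz)%:R * s p ord0 k) ^+ 2) = 
    (fun p => coordz p * partial i (fun q => s q ord0 k) p - (i == iz)%:R * s p ord0 k)
    * (fun p => coordz p * partial i (fun q => s q ord0 k) p - (i == iz)%:R * s p ord0 k).
    by apply/funext => q; rewrite expr2.
  exact: differentiableM.
rewrite /twist; apply: differentiableM.
  have z20 : (fun p => coordz p ^+ 2) p != 0 by rewrite expf_neq0.
  apply: differentiableV => //.
  have -> : (fun p : E => coordz p ^+ 2) = (@coordz R) * (@coordz R).
    by apply/funext => q; rewrite expr2.
  exact: differentiableM.
under eq_fun do rewrite sum3.
by do 2 (apply: differentiableD; last exact: differentiableD); exact: differentiableD.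
Qed.

Lemma pt_continuous : continuous (@pt R).
Proof.
have -> : @pt R = fun q : T => q.1.1 *: delta_mx ord0 ix + q.1.2 *: delta_mx ord0 iy
    + q.2 *: (delta_mx ord0 iz : E).
  apply/funext => -[[a b] c]; apply/esym/pt_eq;
  by rewrite !mxE /= ?mulr1 ?mulr0 ?addr0 ?add0r.
move=> q; apply: cvgD; first apply: cvgD; apply: cvgZr_tmp.
- apply: (@continuous_comp _ _ _ (@fst (R * R) R) (@fst R R)); exact: cvg_fst.
- apply: (@continuous_comp _ _ _ (@fst (R * R) R) (@snd R R)); [exact: cvg_fst|exact: cvg_snd].
- exact: cvg_snd.
Qed.

Lemma open_pt U : open U -> open (@pt R @^-1` U).
Proof. by move=> oU; apply: open_comp => // q _; exact: pt_continuous. Qed.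

Lemma coordz_pt (q : T) : coordz (pt q) = q.2.
Proof. by case: q => [[a b] c]; rewrite /coordz ptE. Qed.

Lemma volume_densityE p : H3 R p -> volume_density p = (coordz p ^+ 3)^-1.
Proof.
move=> pH; rewrite /volume_density /metric det_scalar.
have -> : (coordz p ^+ 2)^-1 ^+ 3 = ((coordz p ^+ 3)^-1) ^+ 2.
  by rewrite -!exprVn -!exprM mulnC.
by rewrite sqrtr_sqr ger0_norm // invr_ge0 exprn_ge0 // ltW.
Qed.

(** The height is bounded away from 0 because the closure is taken in [H3]. *)
Lemma relatively_compact_bounds U : U `<=` H3 R -> relatively_compact U ->
  exists e M : R, [/\ 0 < e, 0 < M & forall p, U p ->
    e <= coordz p /\ forall i, `|p ord0 i| < M].
Proof.
move=> UH cU.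
have [->|U0] := eqVneq U set0; first by exists 1, 1; split=> // p.
have UK : U `<=` closure U `&` H3 R by move=> p Up; split; [exact: subset_closure|exact: UH].
have K0 : (closure U `&` H3 R) !=set0 by move/set0P: U0 => [p /UK]; exists p.
have [c /set_mem [_ cH] cmin] := compact_EVT_min K0 cU
  (continuous_subspaceT (@coordz_continuous R)).
have bnd i : exists2 m : R, 0 <= m & forall p, U p -> `|p ord0 i| <= m.
  have ci : continuous (fun p : E => `|p ord0 i|).
    move=> p; apply: (@continuous_comp _ _ _ (fun p : E => p ord0 i) Num.norm).
      exact: coord_continuous.
    exact: norm_continuous.
  have [d _ dmax] := compact_EVT_max K0 cU (continuous_subspaceT ci).
  by exists `|d ord0 i| => // p /UK Kp; apply: dmax; rewrite inE.
have [mx mx0 Mx] := bnd ix; have [my my0 My] := bnd iy; have [mz mz0 Mz] := bnd iz.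
exists (coordz c), (mx + my + mz + 1); split=> //; first by rewrite ltr_wpDl // !addr_ge0.
move=> p Up; split; first by apply: cmin; rewrite inE; exact: UK.
apply: ord3_ind.
- by apply: le_lt_trans (Mx p Up) _; lra.
- by apply: le_lt_trans (My p Up) _; lra.
- by apply: le_lt_trans (Mz p Up) _; lra.
Qed.


Let mu : {measure set MT -> \bar R} := lebesgue3.

Lemma volume_finite U : open U -> U `<=` H3 R -> relatively_compact U ->
  (lebesgue3 (pt @^-1` U : set MT) < +oo)%E.
Proof.
move=> oU UH cU; have [e [m [e0 m0 b]]] := relatively_compact_bounds UH cU.
have mm : - m < m by rewrite gtrN.
apply: (@le_lt_trans _ _ (lebesgue3 (box3 (- m) m (- m) m (- m) m : set MT))); last first.
  by rewrite lebesgue3_box //; exact: ltry.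
apply: (le_measure mu); rewrite ?inE.
- exact: (open_measurable3 (open_pt oU)).
- exact: measurable_box3.
move=> [[x y] z] /= /b [_ bi]; move: (bi ix) (bi iy) (bi iz).
by rewrite !ptE !ltr_norml => hx hy hz; split; [split|]; rewrite /= in_itv.
Qed.

Section FixedDomain.
Variable (U : set E).
Hypotheses (oU : open U) (UH : U `<=` H3 R) (cU : relatively_compact U).
Local Notation A := (pt @^-1` U : set MT).

Let density (q : T) : R := (q.2 ^+ 3)^-1.

Let A_gt0 (q : T) : A q -> 0 < q.2.
Proof. by move=> /UH; rewrite /H3 /= coordz_pt. Qed.

Let density_ge0 (q : T) : A q -> 0 <= density q.
Proof. by move=> Aq; rewrite invr_ge0 exprn_ge0 // ltW // A_gt0. Qed.

Lemma density_continuous (q : T) : A q -> {for q, continuous density}.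
Proof.
move=> Aq; apply: (@continuous_comp _ _ _ (@snd (R * R) R) (fun z => (z ^+ 3)^-1)).
  exact: cvg_snd.
apply: continuousV; first by rewrite expf_neq0 // gt_eqF // A_gt0.
exact: exprn_continuous.
Qed.

Lemma bounded_integral_finite (f : T -> R) :
  {in A, continuous f} -> (forall q : T, A q -> 0 <= f q) ->
  (exists k : R, forall q : T, A q -> f q <= k) ->
  exists k : R, (\int[lebesgue3]_(q in A) (f q)%:E)%E = k%:E.
Proof.
move=> cf f0 [k fk].
have mA : measurable A by exact: (open_measurable3 (open_pt oU)).
have mf := open_continuous_emeasurable3 (open_pt oU) cf.
have I0 : (0 <= \int[mu]_(q in A) (f q)%:E)%E by apply: integral_ge0 => q Aq; rewrite lee_fin f0.
have Ioo : (\int[mu]_(q in A) (f q)%:E < +oo)%E.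
  apply: (@le_lt_trans _ _ (\int[mu]_(q in A) (`|k|)%:E)%E).
    apply: ge0_le_integral => //.
    by move=> q Aq; rewrite lee_fin (le_trans (fk q Aq)) // ler_norm.
  rewrite integral_cst // lte_mul_pinfty ?lee_fin //.
  exact: volume_finite.
exists (fine (\int[mu]_(q in A) (f q)%:E)%E).
by rewrite fineK // ge0_fin_numE.
Qed.


Lemma twist_density_continuous s : smooth_on U s ->
  {in A, continuous (fun q : T => twist s (pt q) * density q)}.
Proof.
move=> ss q /set_mem Aq; apply: cvgM; last exact: density_continuous.
apply: (@continuous_comp _ _ _ (@pt R) (twist s)); first exact: pt_continuous.
exact/differentiable_continuous/(differentiable_twist oU UH ss).
Qed.

Lemma twist_density_ge0 s (q : T) : A q -> 0 <= twist s (pt q) * density q.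
Proof. by move=> Aq; rewrite mulr_ge0 ?twist_ge0 ?density_ge0. Qed.

Lemma energy_twist s : horospherical U s ->
  energy s U = ((2^-1)%:E * (\int[lebesgue3]_(q in A) (density q)%:E +
    \int[lebesgue3]_(q in A) (twist s (pt q) * density q)%:E))%E.
Proof.
move=> hs; have ss : smooth_on U s by case: hs => [[]].
rewrite /energy; congr (_ * _)%E.
have cd : {in A, continuous density} by move=> q /set_mem; exact: density_continuous.
rewrite -[RHS](ge0_integralD mu (open_measurable3 (open_pt oU)) _
  (open_continuous_emeasurable3 (open_pt oU) cd) _
  (open_continuous_emeasurable3 (open_pt oU) (twist_density_continuous ss))).
- apply: eq_integral => q /set_mem Aq; rewrite -EFinD.
  rewrite (bending_horospherical oU UH hs Aq) volume_densityE; last exact: UH.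
  by rewrite coordz_pt mulrDl mul1r.
- by move=> q Aq; rewrite lee_fin density_ge0.
- by move=> q Aq; rewrite lee_fin twist_density_ge0.
Qed.

Lemma volume_integral : exists2 k : R, 0 <= k &
  (\int[lebesgue3]_(q in A) (density q)%:E)%E = k%:E.
Proof.
have cd : {in A, continuous density} by move=> q /set_mem; exact: density_continuous.
have [|k kE] := bounded_integral_finite cd density_ge0.
  have [e [m [e0 _ b]]] := relatively_compact_bounds UH cU.
  exists (e ^+ 3)^-1 => q Aq; rewrite /density lef_pV2 ?posrE ?exprn_gt0 ?A_gt0 //.
  have [] := b _ Aq; rewrite coordz_pt => eq _.
  by rewrite lerXn2r // nnegrE ltW // A_gt0.
exists k => //; rewrite -lee_fin -kE.
by apply: (@integral_ge0 _ _ _ mu) => q Aq; rewrite lee_fin density_ge0.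
Qed.

(** The integral of [twist (sigma t)] is 4 t^2 times this one, because
z^4 times the volume density z^-3 is z. *)
Lemma height_integral : exists k : R,
  (\int[lebesgue3]_(q in A) (q.2)%:E)%E = k%:E.
Proof.
apply: bounded_integral_finite.
- by move=> q _; exact: cvg_snd.
- by move=> q Aq; rewrite ltW // A_gt0.
have [e [m [_ _ b]]] := relatively_compact_bounds UH cU.
exists m => q Aq; have [_ /(_ iz)] := b _ Aq.
by rewrite -[pt q ord0 iz]/(coordz (pt q)) coordz_pt => /ltW; apply: le_trans; exact: ler_norm.
Qed.

Lemma twist_sigma t p : U p -> twist (sigma t) p = 4 * t ^+ 2 * coordz p ^+ 4.
Proof.
move=> Up; have := bending_horospherical oU UH (sigma_horospherical t oU UH) Up.
by rewrite (bending_sigma t (UH Up)) => /addrI.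
Qed.

(** A continuous function that vanishes almost everywhere on an open set vanishes
everywhere on it. *)
Lemma twist_integral_eq0 s : smooth_on U s ->
  (\int[lebesgue3]_(q in A) (twist s (pt q) * density q)%:E)%E = 0%E <->
  forall p, U p -> twist s p = 0.
Proof.
move=> ss; split=> [I0 p Up|tw0]; last first.
  by apply: integral0_eq => q Aq; rewrite tw0 ?mul0r.
pose q : T := (coordx p, coordy p, coordz p).
have qp : pt q = p by apply/esym/pt_eq.
have Aq : A q by rewrite /= qp.
have cW := twist_density_continuous ss.
have W0 : ae_eq mu A (EFin \o (fun q : T => twist s (pt q) * density q)) (cst 0%E).
  apply/(ae_eq_integral_abs mu (open_measurable3 (open_pt oU))
    (open_continuous_emeasurable3 (open_pt oU) cW)).
  rewrite -[RHS]I0; apply: eq_integral => x /set_mem Ax.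
  by rewrite gee0_abs // lee_fin twist_density_ge0.
have /eqP := ae0_open_eq0 (open_pt oU) cW W0 Aq.
have d0 : density q != 0 by rewrite invr_eq0 expf_neq0 // gt_eqF //; exact: (UH Up).
by rewrite qp mulf_eq0 (negPf d0) orbF => /eqP.
Qed.

(** [k0] is the hyperbolic volume of the domain and [k1] the Euclidean integral of
the height over it. *)
Lemma energy_sigma (k0 k1 : R) t :
  (\int[lebesgue3]_(q in A) (density q)%:E)%E = k0%:E ->
  (\int[lebesgue3]_(q in A) (q.2)%:E)%E = k1%:E ->
  energy (sigma t) U = (2^-1 * (k0 + 4 * t ^+ 2 * k1))%:E.
Proof.
move=> k0E k1E; rewrite (energy_twist (sigma_horospherical t oU UH)) k0E.
rewrite (_ : (\int[_]_(q in _) _)%E = (4 * t ^+ 2 * k1)%:E).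
  by rewrite -EFinD -EFinM.
have c2 : {in A, continuous (@snd (R * R) R)} by move=> q _; exact: cvg_snd.
rewrite EFinM -k1E -(ge0_integralZl_EFin mu (open_measurable3 (open_pt oU)) _
  (open_continuous_emeasurable3 (open_pt oU) c2)).
- apply: eq_integral => q /set_mem Aq; rewrite twist_sigma // coordz_pt -EFinM /density.
  by congr _%:E; field; rewrite gt_eqF // A_gt0.
- by move=> q Aq; rewrite lee_fin ltW // A_gt0.
- by rewrite mulr_ge0 ?sqr_ge0.
Qed.

Lemma energy_minimum : connected U -> exists m : R,
  [/\ exists2 s, horospherical U s & energy s U = m%:E,
      forall s, horospherical U s -> (m%:E <= energy s U)%E,
      forall s, horospherical U s ->
        (energy s U = m%:E <-> invariant_horospherical U s)
    & energy (sigma t) U @[t --> (0 : R)^'] --> m%:E].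
Proof.
move=> conU.
have [k0 k00 k0E] := volume_integral; have [k1 k1E] := height_integral.
have W0 s : (0 <= \int[lebesgue3]_(q in A) (twist s (pt q) * density q)%:E)%E.
  by apply: (@integral_ge0 _ _ _ mu) => q Aq; rewrite lee_fin twist_density_ge0.
exists (2^-1 * k0); split.
- exists (sigma 0); first exact: sigma_horospherical.
  by rewrite (energy_sigma _ k0E k1E) expr0n mulr0 mul0r addr0.
- move=> s hs; rewrite (energy_twist hs) k0E EFinM lee_pmul2l ?lte_fin //.
  by rewrite leeDl.
- move=> s hs; have ss : smooth_on U s by case: hs => [[]].
  have WP := twist_integral_eq0 ss.
  rewrite (energy_twist hs) k0E; split=> [Em|inv].
    apply: twist0_invariant => //; apply/WP.
    move: (W0 s) Em; case: (\int[_]_(_ in _) _)%E => [r|//|//] _.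
      rewrite -EFinD -EFinM => -[] /mulfI; rewrite invr_eq0 pnatr_eq0 => /(_ isT).
      by rewrite -[X in _ = X]addr0 => /addrI ->.
    by rewrite addey // gt0_muley ?lte_fin.
  rewrite (WP.2 _) ?adde0 // => p Up.
  exact: invariant_twist0 inv Up.
- rewrite (_ : (fun t => energy (sigma t) U) =
    EFin \o (fun t => 2^-1 * (k0 + 4 * t ^+ 2 * k1))); last first.
    by apply/funext => t; rewrite (energy_sigma _ k0E k1E).
  apply: cvg_EFin; first exact: nearW.
  pose f (t : R) := 2^-1 * (k0 + 4 * t ^+ 2 * k1).
  have f0 : f 0 = 2^-1 * k0 by rewrite /f expr0n mulr0 mul0r addr0.
  have c0 : {for 0, continuous f}.
    apply: cvgM; first exact: cvg_cst.
    apply: cvgD; first exact: cvg_cst.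
    apply: cvgM; last exact: cvg_cst.
    apply: cvgM; first exact: cvg_cst.
    exact: exprn_continuous.
  rewrite -f0; change (f @ (0 : R)^' --> f 0).
  by apply: cvg_trans c0; apply: cvg_app; exact: cvg_within.
Qed.

End FixedDomain.
End Energy.

Theorem mainTheorem6 (R : realType) :
  (smooth_on [set q : R * 'rV[R]_3 | H3 R q.2] (fun q => sigma q.1 q.2) /\
   forall t : R, horospherical (H3 R) (sigma t)) /\
  (forall t : R,
     harmonic_unit_field (H3 R) (sigma t) /\
     forall p, H3 R p ->
       bending (sigma t) p = 1 + 4 * t ^+ 2 * coordz p ^+ 4) /\
  (forall t : R, t != 0 ->
     forall G : @isom_subgroup R,
       discrete_subgroup G -> compact_quotient G ->
       ~ invariant_under G (sigma t)) /\
  (forall U : set 'rV[R]_3, domain U -> relatively_compact U ->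
     exists m : R,
       [/\ exists2 s, horospherical U s & energy s U = m%:E,
           forall s, horospherical U s -> (m%:E <= energy s U)%E,
           forall s, horospherical U s ->
             (energy s U = m%:E <-> invariant_horospherical U s)
         & energy (sigma t) U @[t --> (0 : R)^'] --> m%:E]).
Proof.
split; first split.
- exact: sigma_jointly_smooth.
- by move=> t; exact: sigma_horospherical (@open_H3 R) _.
split; first by move=> t; split; [exact: sigma_harmonic | exact: bending_sigma].
split; first by move=> t t0 G _ cG; exact: no_cocompact_invariance.
by move=> U [oU conU UH] cU; exact: energy_minimum.
Qed.
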